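(* Let $G$ be an exponential solvable Lie group with Lie algebra $\mathfrak g$, and let $\mathcal V$ be a finite-dimensional real vector space which is a $G$-module of exponential type via a continuous representation $\tau\colon G\to\mathrm{End}(\mathcal V)$. Let $q\colon\mathcal V\to G\setminus\mathcal V$, $v\mapsto\tau(G)v$, be the quotient map onto the orbit space, and for $v\in\mathcal V$ denote $G(v):=\{g\in G\mid \tau(g)v=v\}$. Assume that $\mathcal V=\bigsqcup_{k=1}^n A_k$ is a partition into $G$-invariant subsets such that for $k=1,\dots,n$: (1) the set $D_k:=\bigsqcup_{j=1}^k A_j$ is open in $\mathcal V$; (2) there is a locally closed subset $\Xi_k\subseteq A_k$ such that $q|_{\Xi_k}\colon\Xi_k\to G\setminus A_k$ is a homeomorphism; (3) there is a continuous map $\sigma_{0,k}\colon A_k\to G$ with $\tau(\sigma_{0,k}(v))v=\theta_k(v)$ for all $v\in A_k$, where $\theta_k:=(q|_{\Xi_k})^{-1}\circ q|_{A_k}\colon A_k\to\Xi_k$; (4) the dimension of the $G$-orbits contained in $A_k$ is constant. Define $\Gamma_k:=\bigsqcup_{v\in\Xi_k}\{v\}\times G(v)\subseteq\Xi_k\times G$ and $\Pi_k\colon\Gamma_k\to\Xi_k$, $\Pi_k(v,g)=v$. Then $\Pi_k\colon\Gamma_k\to\Xi_k$ has local cross-sections for $k=1,\dots,n$, and the transformation group $(G,\mathcal V)$ (that is, the transformation groupoid $G\times\mathcal V\rightrightarrows\mathcal V$) is a piecewise pullback of group bundles.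
   Context: An exponential (solvable) Lie group is a Lie group $G$ whose exponential map $\exp_G\colon\mathfrak g\to G$ is bijective (such a group is automatically solvable). Module of exponential type: let $\tau\colon G\to\mathrm{End}(\mathcal V)$ be a continuous representation on a finite-dimensional real vector space, extended by complex linearity to $\mathcal V_{\mathbb C}=\mathbb C\otimes_{\mathbb R}\mathcal V$. By Lie's theorem there is a chain of $\mathfrak g$-invariant complex subspaces $\{0\}=\mathcal V_0\subset\mathcal V_1\subset\cdots\subset\mathcal V_m=\mathcal V_{\mathbb C}$ with $\dim_{\mathbb C}\mathcal V_j=j$; the weights are the $\mathbb R$-linear functionals $\lambda_j\colon\mathfrak g\to\mathbb C$ with $(\mathrm d\tau(X)-\lambda_j(X))\mathcal V_j\subseteq\mathcal V_{j-1}$ for all $X\in\mathfrak g$. The module is of exponential type if for every weight $\lambda$ there are $c\in\mathbb R$ and $\gamma\in\mathfrak g^*$ (real linear functional) with $\lambda(X)=(1+\mathrm i c)\gamma(X)$ for all $X\in\mathfrak g$. A locally compact groupoid $\mathcal G\rightrightarrows\mathcal G^{(0)}$ is a second countable locally compact Hausdorff topological groupoid whose domain and range maps $d,r\colon\mathcal G\to\mathcal G^{(0)}$ are open. For an action of $G$ on a space $X$, the transformation groupoid is $G\times X\rightrightarrows X$ with $d(g,x)=x$, $r(g,x)=g\cdot x$. For a $\mathcal G$-invariant locally closed $A\subseteq\mathcal G^{(0)}$, $\mathcal G_A:=d^{-1}(A)\rightrightarrows A$ is the reduced groupoid. A group bundle is a locally compact groupoid whose domain and range maps are equal. A map $\theta\colon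 X\to Y$ of topological spaces has local cross-sections if for every $y\in Y$ and every $x\in\theta^{-1}(y)$ there are an open neighborhood $V$ of $y$ and a continuous map $\tau\colon V\to X$ with $\tau(y)=x$ and $\theta\circ\tau=\mathrm{id}_V$. Pullback: for a topological groupoid $\mathcal G\rightrightarrows\mathcal G^{(0)}$ and a continuous map $\theta\colon N\to\mathcal G^{(0)}$, the pullback $\theta^{\downarrow\downarrow}(\mathcal G)\rightrightarrows N$ is $\{(n_2,g,n_1)\in N\times\mathcal G\times N\mid d(g)=\theta(n_1),\ r(g)=\theta(n_2)\}$ with the relative topology, $d(n_2,g,n_1)=n_1$, $r(n_2,g,n_1)=n_2$ and multiplication induced from $\mathcal G$. A locally compact groupoid $\mathcal G\rightrightarrows\mathcal G^{(0)}$ is a piecewise pullback of group bundles with pieces $V_1,\dots,V_n$ if: (i) there are open $\mathcal G$-invariant subsets $\emptyset=U_0\subseteq U_1\subseteq\cdots\subseteq U_n=\mathcal G^{(0)}$ with $V_k=U_k\setminus U_{k-1}$; (ii) for each $k$ there are an open continuous surjective map $\theta_k\colon V_k\to S_k$ having local cross-sections and a group bundle $\mathcal T_k\to S_k$ such that $\mathcal G_{V_k}\simeq\theta_k^{\downarrow\downarrow}(\mathcal T_k)$ as topological groupoids. *)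

(* Defs.v *)
From HB Require Import structures.
From mathcomp Require Import all_boot all_order all_algebra.
From mathcomp Require Import all_classical all_reals all_analysis.
From mathcomp Require Import generic_quotient complex.

Set Implicit Arguments.
Unset Strict Implicit.
Unset Printing Implicit Defensive.

Import Order.TTheory GRing.Theory Num.Theory.
Import numFieldNormedType.Exports.

Local Open Scope classical_set_scope.
Local Open Scope ring_scope.
Local Open Scope quotient_scope.

Definition homeomorphism (X Y : topologicalType) (f : X -> Y) :=
  continuous f /\
  exists g : Y -> X, [/\ cancel f g, cancel g f & continuous g].

(* [f] restricts to a homeomorphism from [A] onto [B], both with the relative
   topology. *)
Definition homeomorphism_on (X : ptopologicalType) (Y : topologicalType)
    (A : set X) (B : set Y) (f : X -> Y) :=
  [/\ set_bij A B f, {within A, continuous f} & {within B, continuous (pinv A f)}].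

Definition open_map (X Y : topologicalType) (f : X -> Y) :=
  forall U, open U -> open (f @` U).

Definition locally_closed (X : topologicalType) (A : set X) :=
  exists U F : set X, [/\ open U, closed F & A = U `&` F].

(* A local section is a total function whose values outside [V] are irrelevant;
   as [V] is open, continuity on [V] is continuity at its points. *)
Definition has_local_cross_sections (X Y : topologicalType) (theta : X -> Y) :=
  forall (y : Y) (x : X), theta x = y ->
  exists (V : set Y) (s : Y -> X),
    [/\ open V, V y, {within V, continuous s}, s y = x &
        forall z, V z -> theta (s z) = z].

Lemma continuous_to_set_type (X Y : topologicalType) (A : set Y) (f : X -> A) :
  continuous (fun x => val (f x)) -> continuous f.
Proof.
move=> /continuousP fc; apply/continuousP => _ [B oB <-].
exact: (fc _ oB).
Qed.

Lemma continuous_set_val (Y : topologicalType) (A : set Y) :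
  continuous (fun y : A => val y).
Proof. exact: initial_continuous. Qed.

Lemma continuous_pair (X Y Z : topologicalType) (f : X -> Y) (g : X -> Z) :
  continuous f -> continuous g -> continuous (fun x => (f x, g x)).
Proof. by move=> fc gc x; apply: cvg_pair; [exact: fc|exact: gc]. Qed.

Lemma continuous_o (X Y Z : topologicalType) (f : Y -> Z) (g : X -> Y) :
  continuous f -> continuous g -> continuous (fun x => f (g x)).
Proof. by move=> fc gc x; apply: continuous_comp; [exact: gc|exact: fc]. Qed.

Lemma continuous_fst (X Y : topologicalType) : continuous (@fst X Y).
Proof. by move=> ?; exact: cvg_fst. Qed.

Lemma continuous_snd (X Y : topologicalType) : continuous (@snd X Y).
Proof. by move=> ?; exact: cvg_snd. Qed.

Section Smooth.
Context {R : realType}.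

Fixpoint C_on (k : nat) (n m : nat) (U : set 'rV[R]_n)
    (f : 'rV[R]_n -> 'rV[R]_m) : Prop :=
  (forall x, U x -> {for x, continuous f}) /\
  (if k is k'.+1 then
     forall i : 'I_n,
       (forall x, U x -> derivable f x (delta_mx 0 i)) /\
       C_on k' U ('D_(delta_mx 0 i) f)
   else True).

Definition smooth_on (n m : nat) (U : set 'rV[R]_n)
    (f : 'rV[R]_n -> 'rV[R]_m) := forall k, C_on k U f.

End Smooth.

(* [chart_inv] is only meaningful on the image of [chart_dom]. *)
Record chart (R : realType) (n : nat) (M : topologicalType) := Chart {
  chart_dom : set M;
  chart_fun :> M -> 'rV[R]_n;
  chart_inv : 'rV[R]_n -> M;
  chart_dom_open : open chart_dom;
  chart_img_open : open (chart_fun @` chart_dom);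
  chart_funK : {in chart_dom, cancel chart_fun chart_inv};
  chart_fun_continuous : {within chart_dom, continuous chart_fun};
  chart_inv_continuous : {within chart_fun @` chart_dom, continuous chart_inv}
}.

Section ManifoldSmoothness.
Context {R : realType} {n : nat} {M : topologicalType}.

Definition smooth_between (phi psi : chart R n M) (f : M -> M) :=
  smooth_on (phi @` (chart_dom phi `&` f @^-1` chart_dom psi))
            (psi \o f \o chart_inv phi).

(* A map [M * M -> M] read in the product chart [phi1 x phi2], with
   coordinates concatenated in ['rV_(n + n)]. *)
Definition smooth_between2 (phi1 phi2 psi : chart R n M) (f : M -> M -> M) :=
  let F (z : 'rV[R]_(n + n)) :=
    f (chart_inv phi1 (lsubmx z)) (chart_inv phi2 (rsubmx z)) in
  smooth_on
    [set z | [/\ (phi1 @` chart_dom phi1) (lsubmx z),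
                 (phi2 @` chart_dom phi2) (rsubmx z) & chart_dom psi (F z)]]
    (psi \o F).

End ManifoldSmoothness.

HB.mixin Record isTopologicalGroup G of Group G & Topological G := {
  mulg_continuous : continuous (fun p : G * G => (p.1 * p.2)%g);
  invg_continuous : continuous (fun g : G => (g^-1)%g)
}.

#[short(type="topologicalGroupType")]
HB.structure Definition TopologicalGroup :=
  {G of isTopologicalGroup G & Group G & Topological G}.

HB.mixin Record isLieGroup (R : realType) (n : nat) G of TopologicalGroup G := {
  lie_hausdorff : hausdorff_space G;
  lie_second_countable : @second_countable G;
  atlas : set (chart R n G);
  atlas_cover : forall g : G, exists2 phi, atlas phi & chart_dom phi g;
  atlas_compatible : forall phi psi, atlas phi -> atlas psi ->
    smooth_between phi psi id;
  lie_mulg_smooth : forall phi1 phi2 psi,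
    atlas phi1 -> atlas phi2 -> atlas psi ->
    smooth_between2 phi1 phi2 psi (fun g h : G => (g * h)%g);
  lie_invg_smooth : forall phi psi, atlas phi -> atlas psi ->
    smooth_between phi psi (fun g : G => (g^-1)%g)
}.

#[short(type="lieGroupType")]
HB.structure Definition LieGroup (R : realType) (n : nat) :=
  {G of isLieGroup R n G & TopologicalGroup G}.

Section ExponentialMap.
Context {R : realType} {n : nat} {G : lieGroupType R n}.

Definition one_parameter_subgroup (gamma : R -> G) :=
  continuous gamma /\ forall s t, gamma (s + t) = (gamma s * gamma t)%g.

(* The Lie algebra is the tangent space at [1], identified with ['rV[R]_n] by
   the chart [phi] around [1]: [t |-> expG (t X)] is the one-parameter subgroup
   with initial velocity [X]. These conditions determine [expG]. *)
Definition exponential_map (phi : chart R n G) (expG : 'rV[R]_n -> G) :=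
  forall X : 'rV[R]_n,
    one_parameter_subgroup (fun t : R => expG (t *: X)) /\
    is_derive (0 : R) 1 (fun t : R => phi (expG (t *: X))) X.

(* [G] is an exponential Lie group and [expG] is its exponential map, in the
   coordinates on the Lie algebra given by the chart [phi]. *)
Definition exponential_lie_group (phi : chart R n G) (expG : 'rV[R]_n -> G) :=
  [/\ atlas phi, chart_dom phi 1%g, exponential_map phi expG & bijective expG].

End ExponentialMap.

Record action (G : topologicalGroupType) (X : topologicalType) := Action {
  act :> G -> X -> X;
  act1 : forall x, act 1%g x = x;
  actM : forall g h x, act (g * h)%g x = act g (act h x);
  act_continuous : continuous (fun p : G * X => act p.1 p.2)
}.

Section Orbits.
Context {G : topologicalGroupType} {X : topologicalType} (a : action G X).

Definition same_orbit : rel X := fun x y => `[< exists g, y = a g x >].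

Lemma same_orbit_refl : reflexive same_orbit.
Proof. by move=> x; apply/asboolP; exists 1%g; rewrite act1. Qed.

Lemma same_orbit_sym : symmetric same_orbit.
Proof.
by move=> x y; apply/asboolP/asboolP => -[g ->]; exists (g^-1)%g;
  rewrite -actM mulVg act1.
Qed.

Lemma same_orbit_trans : transitive same_orbit.
Proof.
move=> y x z /asboolP[g ->] /asboolP[h ->]; apply/asboolP.
by exists (h * g)%g; rewrite actM.
Qed.

Canonical same_orbit_equiv :=
  EquivRel same_orbit same_orbit_refl same_orbit_sym same_orbit_trans.

Definition orbit_space := quotient_topology {eq_quot same_orbit_equiv}.
HB.instance Definition _ := Topological.on orbit_space.

Definition orbit_map (x : X) : orbit_space := \pi_{eq_quot same_orbit_equiv} x.

Definition act_invariant (A : set X) := forall g x, A x -> A (a g x).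

Definition stabilizer (x : X) : set G := [set g | a g x = x].

End Orbits.

Record representation (R : realType) (G : topologicalGroupType) (m : nat) :=
  Representation {
    rep :> G -> 'M[R]_m;
    rep1 : rep 1%g = 1%:M;
    repM : forall g h, rep (g * h)%g = rep g *m rep h;
    rep_continuous : continuous rep
  }.

Section LinearAction.
Context {R : realType} {G : topologicalGroupType} {m : nat}.
Variable tau : representation R G m.

Lemma linear_act1 (v : 'cV[R]_m) : tau 1%g *m v = v.
Proof. by rewrite rep1 mul1mx. Qed.

Lemma linear_actM g h (v : 'cV[R]_m) : tau (g * h)%g *m v = tau g *m (tau h *m v).
Proof. by rewrite repM mulmxA. Qed.

Lemma linear_act_continuous :
  continuous (fun p : G * 'cV[R]_m => tau p.1 *m p.2).
Proof.
have entry (i : 'I_m) (j : 'I_1) :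
    continuous (fun p : G * 'cV[R]_m => (tau p.1 *m p.2) i j).
  move=> q; under eq_fun do rewrite mxE.
  apply: (@cvg_big R _ +%R 0 xpredT (@add_continuous R)) => k _; apply: cvgM.
    apply: (@continuous_comp _ _ _ (fun p : G * 'cV[R]_m => tau p.1)
      (fun M : 'M[R]_m => M i k)); last exact: coord_continuous.
    by apply: continuous_o; [exact: rep_continuous|exact: continuous_fst].
  apply: (@continuous_comp _ _ _ (@snd G 'cV[R]_m) (fun M : 'cV[R]_m => M k j)).
    exact: continuous_snd.
  exact: coord_continuous.
move=> p A [P P_nbhs PA].
have : \forall q \near p, forall i j, P i j ((tau q.1 *m q.2) i j).
  apply: (@filter_forall _ _ (fun i q => forall j, P i j ((tau q.1 *m q.2) i j)) (nbhs p)) => i.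
  apply: (@filter_forall _ _ (fun j q => P i j ((tau q.1 *m q.2) i j)) (nbhs p)) => j.
  exact: (entry i j p _ (P_nbhs i j)).
by apply: filterS => q Pq; exact: PA.
Qed.

Definition linear_action : action G 'cV[R]_m :=
  @Action G 'cV[R]_m (fun g v => tau g *m v)
    linear_act1 linear_actM linear_act_continuous.

End LinearAction.

Section ExponentialType.
Context {R : realType} {n : nat} {G : lieGroupType R n} {m : nat}.
Variables (expG : 'rV[R]_n -> G) (tau : representation R G m).

Definition drep (X : 'rV[R]_n) : 'M[R]_m :=
  derive1 (fun t : R => tau (expG (t *: X))) 0.

(* The extension of [drep X] to the complexification ['cV[R[i]]_m]. *)
Definition drepC (X : 'rV[R]_n) : 'M[R[i]]_m := map_mx (real_complex R) (drep X).

Definition complete_flag (W : nat -> {vspace 'cV[R[i]]_m}) :=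
  (forall j, (j <= m)%N -> \dim (W j) = j) /\
  (forall j, (j < m)%N -> (W j <= W j.+1)%VS).

Definition invariant_flag (W : nat -> {vspace 'cV[R[i]]_m}) :=
  complete_flag W /\
  forall X j u, (j <= m)%N -> u \in W j -> drepC X *m u \in W j.

Definition real_linear (lambda : 'rV[R]_n -> R[i]) :=
  forall (a : R) X Y,
    lambda (a *: X + Y) = real_complex R a * lambda X + lambda Y.

(* [lambda] is the weight on the quotient [W j.+1 / W j]. *)
Definition weight (W : nat -> {vspace 'cV[R[i]]_m}) (j : nat)
    (lambda : 'rV[R]_n -> R[i]) :=
  real_linear lambda /\
  forall X u, u \in W j.+1 -> drepC X *m u - lambda X *: u \in W j.

(* A flag and its weights exist by Lie's theorem, and up to reordering the
   weights do not depend on the flag. *)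
Definition exponential_type :=
  exists (W : nat -> {vspace 'cV[R[i]]_m}) (lambda : nat -> 'rV[R]_n -> R[i]),
    [/\ invariant_flag W,
        forall j, (j < m)%N -> weight W j (lambda j) &
        forall j, (j < m)%N ->
          exists (c : R) (gamma : {scalar 'rV[R]_n}),
            forall X, lambda j X = Complex 1 c * real_complex R (gamma X)].

(* The orbit of [v] is the homogeneous space [G / G(v)], so its dimension is
   [dim G - dim G(v)]; the Lie algebra of the closed subgroup [G(v)] is the
   space of all [X] whose one-parameter subgroup stays in [G(v)]. *)
Definition orbit_dimension (v : 'cV[R]_m) (d : nat) :=
  exists W : {vspace 'rV[R]_n},
    (forall X, X \in W <->
       forall t : R, stabilizer (linear_action tau) v (expG (t *: X))) /\
    (d + \dim W)%N = n.

End ExponentialType.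

Record groupoid := Groupoid {
  arrow : topologicalType;
  object : topologicalType;
  dom : arrow -> object;
  ran : arrow -> object;
  idn : object -> arrow;
  ginv : arrow -> arrow;
  gcomp : forall g h : arrow, dom g = ran h -> arrow;
  dom_idn : forall x, dom (idn x) = x;
  ran_idn : forall x, ran (idn x) = x;
  dom_ginv : forall g, dom (ginv g) = ran g;
  ran_ginv : forall g, ran (ginv g) = dom g;
  dom_gcomp : forall g h (gh : dom g = ran h), dom (gcomp gh) = dom h;
  ran_gcomp : forall g h (gh : dom g = ran h), ran (gcomp gh) = ran g;
  gcompA : forall g h k (gh : dom g = ran h) (hk : dom h = ran k)
    (gh_k : dom (gcomp gh) = ran k) (g_hk : dom g = ran (gcomp hk)),
    gcomp gh_k = gcomp g_hk;
  gcomp_idl : forall g (e : dom (idn (ran g)) = ran g), gcomp e = g;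
  gcomp_idr : forall g (e : dom g = ran (idn (dom g))), gcomp e = g;
  gcompV : forall g (e : dom g = ran (ginv g)), gcomp e = idn (ran g);
  gcompVl : forall g (e : dom (ginv g) = ran g), gcomp e = idn (dom g);
  dom_continuous : continuous dom;
  ran_continuous : continuous ran;
  idn_continuous : continuous idn;
  ginv_continuous : continuous ginv;
  gcomp_continuous :
    continuous (fun p : [set p : arrow * arrow | dom p.1 = ran p.2] =>
                  gcomp (set_valP p))
}.

Definition locally_compact_groupoid (Gr : groupoid) :=
  [/\ @second_countable (arrow Gr), locally_compact [set: arrow Gr],
      hausdorff_space (arrow Gr), open_map (@dom Gr) & open_map (@ran Gr)].

Definition group_bundle (T : groupoid) :=
  locally_compact_groupoid T /\ forall g : arrow T, dom g = ran g.

Definition groupoid_isomorphic (Gr Hr : groupoid) :=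
  exists (F : arrow Gr -> arrow Hr) (f : object Gr -> object Hr),
    [/\ homeomorphism F, homeomorphism f,
        forall g, dom (F g) = f (dom g),
        forall g, ran (F g) = f (ran g) &
        forall g h (gh : dom g = ran h) (FgFh : dom (F g) = ran (F h)),
          F (gcomp gh) = gcomp FgFh].

Definition groupoid_invariant (Gr : groupoid) (A : set (object Gr)) :=
  forall g : arrow Gr, A (dom g) <-> A (ran g).

Section TransformationGroupoid.
Context {G : topologicalGroupType} {X : topologicalType} (a : action G X).

Let T := (G * X)%type.
Let d (p : T) : X := p.2.
Let r (p : T) : X := a p.1 p.2.
Let i (x : X) : T := (1%g, x).
Let v (p : T) : T := ((p.1^-1)%g, a p.1 p.2).
Let c (p q : T) of d p = r q : T := ((p.1 * q.1)%g, q.2).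

Definition transformation_groupoid : groupoid.
Proof.
apply: (@Groupoid T X d r i v c).
- by [].
- by move=> x; rewrite /r /i /= act1.
- by [].
- by move=> p; rewrite /r /v /d /= -actM mulVg act1.
- by [].
- by move=> p q pq; rewrite /r /c /= actM -/(r q) -pq.
- by move=> p q s pq qs pq_s p_qs; rewrite /c /= mulgA.
- by move=> [g x] e; rewrite /c /= mul1g.
- by move=> [g x] e; rewrite /c /i /d /= mulg1.
- by move=> [g x] e; rewrite /c /i /r /= mulgV.
- by move=> [g x] e; rewrite /c /i /d /= mulVg.
- exact: continuous_snd.
- exact: act_continuous.
- by apply: continuous_pair => x; [exact: cvg_cst|exact: cvg_id].
- apply: continuous_pair; last exact: act_continuous.
  by apply: continuous_o; [exact: invg_continuous|exact: continuous_fst].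
- have sv := @continuous_set_val _ [set p : T * T | d p.1 = r p.2].
  have s1 := continuous_o (@continuous_fst _ _) sv.
  have s2 := continuous_o (@continuous_snd _ _) sv.
  apply: continuous_pair; last first.
    exact: (continuous_o (@continuous_snd _ _) s2).
  apply: (continuous_o (@mulg_continuous G)
    (g := fun p : [set p : T * T | d p.1 = r p.2] =>
            ((val p).1.1, (val p).2.1))).
  apply: continuous_pair; first exact: (continuous_o (@continuous_fst _ _) s1).
  exact: (continuous_o (@continuous_fst _ _) s2).
Defined.

End TransformationGroupoid.

Section Reduction.
Context {Gr : groupoid} {A : set (object Gr)} (Ainv : groupoid_invariant A).

Let T : set (arrow Gr) := @dom Gr @^-1` A.

Let d (g : T) : A := SigSub (mem_set (set_valP g : A (dom (val g)))).
Let r (g : T) : A := SigSub (mem_set ((Ainv (val g)).1 (set_valP g) : A (ran (val g)))).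

Let iP (x : A) : T (idn (val x)).
Proof. by rewrite /T /= dom_idn; exact: set_valP. Qed.
Let i (x : A) : T := SigSub (mem_set (iP x)).

Let vP (g : T) : T (ginv (val g)).
Proof. by rewrite /T /= dom_ginv; apply/Ainv; exact: (set_valP g). Qed.
Let v (g : T) : T := SigSub (mem_set (vP g)).

Let cE (g h : T) (gh : d g = r h) : dom (val g) = ran (val h) := congr1 val gh.
Let cP (g h : T) (gh : d g = r h) : T (gcomp (cE gh)).
Proof. by rewrite /T /= dom_gcomp; exact: (set_valP h). Qed.
Let c (g h : T) (gh : d g = r h) : T := SigSub (mem_set (cP gh)).

Definition reduced_groupoid : groupoid.
Proof.
apply: (@Groupoid T A d r i v c).
- by move=> x; apply: val_inj; exact: dom_idn.
- by move=> x; apply: val_inj; exact: ran_idn.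
- by move=> g; apply: val_inj; exact: dom_ginv.
- by move=> g; apply: val_inj; exact: ran_ginv.
- by move=> g h gh; apply: val_inj; exact: dom_gcomp.
- by move=> g h gh; apply: val_inj; exact: ran_gcomp.
- by move=> g h k gh hk gh_k g_hk; apply: val_inj; exact: gcompA.
- by move=> g e; apply: val_inj; exact: gcomp_idl.
- by move=> g e; apply: val_inj; exact: gcomp_idr.
- by move=> g e; apply: val_inj; exact: gcompV.
- by move=> g e; apply: val_inj; exact: gcompVl.
- apply: continuous_to_set_type.
  exact: (continuous_o (@dom_continuous Gr) (@continuous_set_val _ T)).
- apply: continuous_to_set_type.
  exact: (continuous_o (@ran_continuous Gr) (@continuous_set_val _ T)).
- apply: continuous_to_set_type.
  exact: (continuous_o (@idn_continuous Gr) (@continuous_set_val _ A)).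
- apply: continuous_to_set_type.
  exact: (continuous_o (@ginv_continuous Gr) (@continuous_set_val _ T)).
- apply: continuous_to_set_type.
  pose P := [set p : T * T | d p.1 = r p.2].
  pose Q := [set p : arrow Gr * arrow Gr | dom p.1 = ran p.2].
  have jP (p : P) : Q (val (val p).1, val (val p).2).
    exact: (cE (set_valP p)).
  pose j (p : P) : Q := SigSub (mem_set (jP p)).
  have jc : continuous j.
    apply: continuous_to_set_type; apply: continuous_pair;
      apply: (continuous_o (@continuous_set_val _ T)).
      exact: (continuous_o (@continuous_fst _ _) (@continuous_set_val _ P)).
    exact: (continuous_o (@continuous_snd _ _) (@continuous_set_val _ P)).
  have <- : (fun p : P => gcomp (set_valP (j p))) =
            (fun p : P => val (c (set_valP p))).
    by apply: funext => p /=; congr gcomp; exact: Prop_irrelevance.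
  exact: (continuous_o (@gcomp_continuous Gr) jc).
Defined.

End Reduction.

Lemma gcomp_cast (Gr : groupoid) (g g' h h' : arrow Gr)
    (e : dom g = ran h) (e' : dom g' = ran h') :
  g = g' -> h = h' -> gcomp e = gcomp e'.
Proof.
by move=> gg' hh'; subst g' h'; congr gcomp; exact: Prop_irrelevance.
Qed.

Section Pullback.
Context {Gr : groupoid} {N : topologicalType} {theta : N -> object Gr}.
Variable theta_continuous : continuous theta.

(* Triples [(n2, g, n1)] are encoded as [((n2, g), n1)]. *)
Let T : set (N * arrow Gr * N) :=
  [set p | dom p.1.2 = theta p.2 /\ ran p.1.2 = theta p.1.1].

Let d (p : T) : N := (val p).2.
Let r (p : T) : N := (val p).1.1.
Let a (p : T) : arrow Gr := (val p).1.2.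

Let iP (x : N) : T (x, idn (theta x), x).
Proof. by split; rewrite /= ?dom_idn ?ran_idn. Qed.
Let i (x : N) : T := SigSub (mem_set (iP x)).

Let vP (p : T) : T (d p, ginv (a p), r p).
Proof.
by have [? ?] := set_valP p; split; rewrite /= ?dom_ginv ?ran_ginv.
Qed.
Let v (p : T) : T := SigSub (mem_set (vP p)).

Let cE (p q : T) (pq : d p = r q) : dom (a p) = ran (a q).
Proof.
have [-> _] := set_valP p; have [_ ->] := set_valP q.
by rewrite -/(d p) -/(r q) pq.
Qed.
Let cP (p q : T) (pq : d p = r q) : T (r p, gcomp (cE pq), d q).
Proof.
have [_ ?] := set_valP p; have [? _] := set_valP q.
by split; rewrite /= ?dom_gcomp ?ran_gcomp.
Qed.
Let c (p q : T) (pq : d p = r q) : T := SigSub (mem_set (cP pq)).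

Let dc : continuous d.
Proof. exact: (continuous_o (@continuous_snd _ _) (@continuous_set_val _ T)). Qed.
Let c1 : continuous (fun p : T => (val p).1).
Proof. exact: (continuous_o (@continuous_fst _ _) (@continuous_set_val _ T)). Qed.
Let rc : continuous r.
Proof. exact: (continuous_o (@continuous_fst _ _) c1). Qed.
Let ac : continuous a.
Proof. exact: (continuous_o (@continuous_snd _ _) c1). Qed.

Definition pullback_groupoid : groupoid.
Proof.
apply: (@Groupoid T N d r i v c).
- by [].
- by [].
- by [].
- by [].
- by [].
- by [].
- move=> p q s pq qs pq_s p_qs; apply: val_inj; rewrite /= /a /=.
  by congr (_, _, _); exact: gcompA.
- move=> p e; apply: val_inj; case: p e => -[[n2 g] n1] /= pT e.
  congr (_, _, _).
  have [_ /= rg] : T (n2, g, n1) by exact: set_mem.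
  have e0 : dom (idn (ran g)) = ran g by rewrite dom_idn.
  rewrite -[RHS](gcomp_idl e0); apply: gcomp_cast => //.
  by rewrite /a /i /= rg.
- move=> p e; apply: val_inj; case: p e => -[[n2 g] n1] /= pT e.
  congr (_, _, _).
  have [/= dg _] : T (n2, g, n1) by exact: set_mem.
  have e0 : dom g = ran (idn (dom g)) by rewrite ran_idn.
  rewrite -[RHS](gcomp_idr e0); apply: gcomp_cast => //.
  by rewrite /a /i /= dg.
- move=> p e; apply: val_inj; case: p e => -[[n2 g] n1] /= pT e.
  have [_ /= rg] : T (n2, g, n1) by exact: set_mem.
  congr (_, _, _); rewrite /r /= -rg; exact: gcompV.
- move=> p e; apply: val_inj; case: p e => -[[n2 g] n1] /= pT e.
  have [/= dg _] : T (n2, g, n1) by exact: set_mem.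
  congr (_, _, _); rewrite /d /= -dg; exact: gcompVl.
- exact: dc.
- exact: rc.
- apply: continuous_to_set_type; apply: continuous_pair.
    apply: continuous_pair; first by move=> x; exact: cvg_id.
    exact: (continuous_o (@idn_continuous Gr) theta_continuous).
  by move=> x; exact: cvg_id.
- apply: continuous_to_set_type; apply: continuous_pair => //.
  by apply: continuous_pair => //; exact: (continuous_o (@ginv_continuous Gr) ac).
- apply: continuous_to_set_type.
  pose P := [set p : T * T | d p.1 = r p.2].
  pose Q := [set p : arrow Gr * arrow Gr | dom p.1 = ran p.2].
  have P1 := continuous_o (@continuous_fst _ _) (@continuous_set_val _ P).
  have P2 := continuous_o (@continuous_snd _ _) (@continuous_set_val _ P).
  have jP (p : P) : Q (a (val p).1, a (val p).2).
    exact: (cE (set_valP p)).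
  pose j (p : P) : Q := SigSub (mem_set (jP p)).
  have jc : continuous j.
    apply: continuous_to_set_type; apply: continuous_pair.
      exact: (continuous_o ac P1).
    exact: (continuous_o ac P2).
  apply: continuous_pair; last exact: (continuous_o dc P2).
  apply: continuous_pair; first exact: (continuous_o rc P1).
  have <- : (fun p : P => gcomp (set_valP (j p))) =
            (fun p : P => gcomp (cE (set_valP p))).
    by apply: funext => p; exact: gcomp_cast.
  exact: (continuous_o (@gcomp_continuous Gr) jc).
Defined.

End Pullback.

Definition piecewise_pullback_with_pieces (Gr : groupoid) (n : nat)
    (V : nat -> set (object Gr)) :=
  locally_compact_groupoid Gr /\
  exists U : nat -> set (object Gr),
    [/\ U 0%N = set0, U n = setT,
        forall k, (k < n)%N -> U k `<=` U k.+1,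
        forall k, (k <= n)%N -> open (U k) /\ groupoid_invariant (U k) &
        forall k, (k < n)%N ->
          V k = U k.+1 `\` U k /\
          exists (Vinv : groupoid_invariant (V k)) (T : groupoid)
                 (theta : V k -> object T) (thetac : continuous theta),
            [/\ group_bundle T, open_map theta, range theta = setT,
                has_local_cross_sections theta &
                groupoid_isomorphic (reduced_groupoid Vinv)
                                    (pullback_groupoid thetac)]].

Definition piecewise_pullback_of_group_bundles (Gr : groupoid) :=
  exists n V, @piecewise_pullback_with_pieces Gr n V.

Section IsotropyBundle.
Context {G : topologicalGroupType} {X : topologicalType} (a : action G X).
Variable Xi : set X.

Definition isotropy_bundle : set (X * G) :=
  [set p | Xi p.1 /\ stabilizer a p.1 p.2].

Definition isotropy_projection (p : isotropy_bundle) : Xi :=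
  SigSub (mem_set (proj1 (set_valP p))).

End IsotropyBundle.

(* Main.v *)
Require Import Defs.
From HB Require Import structures.
From mathcomp Require Import all_boot all_order all_algebra.
From mathcomp Require Import all_classical all_reals all_analysis.
From mathcomp Require Import generic_quotient complex.
From mathcomp Require Import lra ring.

Set Implicit Arguments.
Unset Strict Implicit.
Unset Printing Implicit Defensive.

Import Order.TTheory GRing.Theory Num.Theory.
Import numFieldNormedType.Exports.

Local Open Scope classical_set_scope.
Local Open Scope ring_scope.

(** The proof has two parts: the isotropy groups [G(v)] vary continuously
    along a slice, and the given maps [sigma_{0,k}] trivialize the action over
    [A_k] up to these groups.

    Isotropy. In a module of exponential type the eigenvalues of [d tau(X)]
    are numbers [(1 + ic) gamma(X)], which lie on the imaginary axis only if
    they vanish. A solution of [u' = d tau(X) u] of period 1 is therefore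
    constant, so that [tau(exp X) v = v] forces [tau(exp tX) v = v] for all
    [t] ([stabilizer_exp]). As [exp] is onto, [G(v)] is the image under [exp]
    of its Lie algebra [g(v)], whose dimension is constant on [A_k] by
    hypothesis. The set of pairs [(v, X)] with [X] in [g(v)] is closed, and a
    closed family of subspaces of constant dimension has continuous local
    sections ([subspace_field_section]): project a given [X0] in [g(v0)] to
    [g(v)] along a fixed complement of [g(v0)]. Composing with [exp] gives the
    local cross-sections of the isotropy bundle
    ([isotropy_projection_sections]).

    This uses that [exp] is continuous ([continuous_exp]), whereas [exp] is
    given one line at a time, by one-parameter subgroups and their velocities
    at 0. In a chart at the identity the group law [mu] is of class C^2 and
    has the identity as neutral element, hence
    [|mu(x,y) - mu(x',y)| <= (1 + C |y - e|) |x - x'|]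
    ([chart_mul_lipschitz]). Comparing the powers of [exp (X/N)] and
    [exp (Y/N)] step by step then is a discrete form of Gronwall's inequality.

    Pullback. Over [A_k] the map [theta v = sigma(v) v] is a continuous
    retraction onto a slice that meets each orbit once, and
    [(g, v) |-> (gv, (theta v, sigma(gv) g sigma(v)^-1), v)] is an isomorphism
    from the reduction of the transformation groupoid to the pullback of the
    isotropy bundle ([reduced_pullback_isomorphic]). The map [theta] is open
    since the image of an open set is the trace on the slice of the union of
    its translates, and [z |-> sigma(x)^-1 z] is a section of [theta] through
    [x]. The isotropy bundle is locally compact as a locally closed subset of
    [V x G], and its projection is open because it has local cross-sections. *)

(** * Limits of matrix-valued maps *)

Section MatrixLimits.
Variable R : realType.

Lemma mx_norm_coord (p n : nat) (x : 'M[R]_(p, n)) i j : `|x i j| <= `|x|.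
Proof.
rewrite [leRHS]/Num.Def.normr/= mx_normrE.
exact: (le_bigmax _ (fun ij => `|x ij.1 ij.2|) (i, j)).
Qed.

Lemma mx_norm_le (p n : nat) (x : 'M[R]_(p, n)) (C : R) : 0 <= C ->
  (forall i j, `|x i j| <= C) -> `|x| <= C.
Proof.
move=> C0 xC; rewrite [leLHS]/Num.Def.normr/= mx_normrE.
by apply: bigmax_le => // -[i j] _ /=.
Qed.

Lemma mx_norm_lt (p n : nat) (x : 'M[R]_(p, n)) (C : R) : 0 < C ->
  (forall i j, `|x i j| < C) -> `|x| < C.
Proof.
move=> C0 xC; rewrite [ltLHS]/Num.Def.normr/= mx_normrE.
by apply: bigmax_lt => // -[i j] _ /=.
Qed.

Lemma near_dist_lt (V : normedModType R) (z : V) (eps : R) : 0 < eps ->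
  \forall w \near z, `|z - w| < eps.
Proof.
by move=> e0; apply/nbhs_ballP; exists eps => //= w; rewrite -ball_normE.
Qed.

Lemma cvg_mx (T : Type) (F : set_system T) (FF : Filter F) (p n : nat)
    (f : T -> 'M[R]_(p, n)) (l : 'M[R]_(p, n)) :
  (forall i j, f t i j @[t --> F] --> l i j) -> f @ F --> l.
Proof.
move=> fl A [P Pl PA].
have : \forall t \near F, forall i j, P i j (f t i j).
  apply: (filter_forall (f := fun i t => forall j, P i j (f t i j))) => i.
  apply: (filter_forall (f := fun j t => P i j (f t i j))) => j.
  exact: (fl i j _ (Pl i j)).
by apply: filterS => t Pt; exact: PA.
Qed.

Lemma cvg_det (T : Type) (F : set_system T) (FF : Filter F) (n : nat)
    (f : T -> 'M[R]_n) (l : 'M[R]_n) :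
  (forall i j, f t i j @[t --> F] --> l i j) ->
  \det (f t) @[t --> F] --> \det l.
Proof.
move=> fl; apply: (@cvg_big R _ +%R 0 xpredT (@add_continuous R)) => s _.
apply: cvgM; first exact: cvg_cst.
apply: (@cvg_big R _ *%R 1 xpredT (@mul_continuous R)) => i _; exact: fl.
Qed.

Lemma continuous_lsubmx (n p : nat) : continuous (@lsubmx R 1 n p).
Proof.
move=> z; apply: (cvg_mx (nbhs_filter (z : 'rV[R]_(n + p)))) => i j.
rewrite mxE; under eq_fun do rewrite mxE.
exact: coord_continuous.
Qed.

Lemma continuous_rsubmx (n p : nat) : continuous (@rsubmx R 1 n p).
Proof.
move=> z; apply: (cvg_mx (nbhs_filter (z : 'rV[R]_(n + p)))) => i j.
rewrite mxE; under eq_fun do rewrite mxE.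
exact: coord_continuous.
Qed.

Lemma continuous_mulmxr (p q r : nat) (M : 'M[R]_(q, r)) :
  continuous (fun u : 'M[R]_(p, q) => u *m M).
Proof.
move=> u; apply: (cvg_mx (nbhs_filter (u : 'M[R]_(p, q)))) => i j.
rewrite mxE; under eq_fun do rewrite mxE.
apply: (@cvg_big R _ +%R 0 xpredT (@add_continuous R)) => k _.
by apply: cvgM; [exact: coord_continuous | exact: cvg_cst].
Qed.

(** A finite family of maps that are continuous at a point has a common bound
    near it; this bounds all second partial derivatives of the group law at
    once. *)
Lemma near_bounded (T : topologicalType) (I : finType) (p n : nat)
    (h : I -> T -> 'M[R]_(p, n)) (z : T) :
  (forall i, {for z, continuous (h i)}) ->
  exists2 C, 0 <= C & \forall w \near z, forall i, `|h i w| <= C.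
Proof.
move=> hc; exists (\big[Num.max/0]_i (`|h i z| + 1)).
  exact: bigmax_ge_id.
apply: filter_forall => i; near=> w.
apply: le_trans (le_bigmax _ (fun i => `|h i z| + 1) i).
rewrite -[h i w](subrK (h i z)) addrC.
apply: le_trans (ler_normD _ _) _; rewrite lerD2l distrC.
near: w; move: (hc i) => /cvgrPdist_le; exact.
Unshelve. all: by end_near. Qed.

End MatrixLimits.

(** * Derivatives of matrix-valued maps *)

Section MatrixDerivatives.
Variable R : realType.

(** Directional derivatives only see the restriction to a line, so they are
    transported by any map that is affine along that line. *)
Lemma is_derive_affine (V W U : normedModType R) (phi : V -> W) (v a : V)
    (w : W) (f : W -> U) (d : U) :
  (forall h : R, phi (h *: v + a) = h *: w + phi a) ->
  is_derive (phi a) w f d -> is_derive a v (f \o phi) d.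
Proof.
move=> phiE [df fd].
have E : (fun h : R => h^-1 *: ((f \o phi) (h *: v + a) - (f \o phi) a)) =
         (fun h : R => h^-1 *: (f (h *: w + phi a) - f (phi a))).
  by apply/funext => h /=; rewrite phiE.
split; first by rewrite /derivable E; exact: df.
by rewrite /derive E; exact: fd.
Qed.

Lemma is_derive_comp_addr (W : normedModType R) (f : R -> W)
    (df : W) (t s : R) :
  is_derive (t + s) 1 f df -> is_derive t 1 (fun x => f (x + s)) df.
Proof.
move=> h; apply: (@is_derive_affine R R W (fun x => x + s) 1 t 1 f df) => // k.
by rewrite addrA.
Qed.

Lemma is_derive_coord (V : normedModType R) (p n : nat) (M : V -> 'M[R]_(p, n))
    (t v : V) i j :
  derivable M t v -> is_derive t v (fun x => M x i j) ('D_v M t i j).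
Proof.
move=> dM; split; first exact: (derivable_mxP _ _ _).1 dM i j.
by rewrite derive_mx // mxE.
Qed.

Lemma is_derive_mxP (V : normedModType R) (p n : nat) (f : V -> 'M[R]_(p, n))
    (df : 'M[R]_(p, n)) (t v : V) :
  is_derive t v f df <-> forall i j, is_derive t v (fun x => f x i j) (df i j).
Proof.
split=> [[dF <-] i j|h]; first exact: is_derive_coord.
have dF : derivable f t v by apply/derivable_mxP => i j; have [] := h i j.
split=> //; rewrite derive_mx //; apply/matrixP => i j; rewrite mxE.
by have [] := h i j.
Qed.

Lemma is_derive_mx00 (V : normedModType R) (f : V -> 'M[R]_1)
    (df : 'M[R]_1) (t v : V) :
  is_derive t v f df -> is_derive t v (fun x => f x 0 0) (df 0 0).
Proof. by move=> /is_derive_mxP. Qed.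

Lemma is_derive_lin_sum (V : normedModType R) (k : nat) (a : 'I_k -> R)
    (f : 'I_k -> V -> R) (df : 'I_k -> R) (t v : V) :
  (forall i, is_derive t v (f i) (df i)) ->
  is_derive t v (fun x => \sum_i a i * f i x) (\sum_i a i * df i).
Proof.
move=> h.
have := @is_derive_sum _ _ _ k (fun i => a i *: f i) t v (fun i => a i *: df i)
  (fun i => is_deriveZ (a i) (h i)).
by rewrite (_ : \sum_(i < k) a i *: f i = (fun x => \sum_i a i * f i x)) //;
  apply/funext => x; rewrite fct_sumE.
Qed.

Lemma is_derive_mulmxl (V : normedModType R) (q p n : nat) (A : 'M[R]_(q, p))
    (f : V -> 'M[R]_(p, n)) (df : 'M[R]_(p, n)) (t v : V) :
  is_derive t v f df -> is_derive t v (fun x => A *m f x) (A *m df).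
Proof.
move=> /is_derive_mxP h; apply/is_derive_mxP => i j.
rewrite mxE; under eq_fun do rewrite mxE.
by apply: is_derive_lin_sum => k; exact: h.
Qed.

Lemma is_derive_mulmxr (V : normedModType R) (q p n : nat) (B : 'M[R]_(p, n))
    (f : V -> 'M[R]_(q, p)) (df : 'M[R]_(q, p)) (t v : V) :
  is_derive t v f df -> is_derive t v (fun x => f x *m B) (df *m B).
Proof.
move=> /is_derive_mxP h; apply/is_derive_mxP => i j.
rewrite mxE; under eq_fun do rewrite mxE.
under eq_fun do under eq_bigr do rewrite mulrC; under eq_bigr do rewrite mulrC.
by apply: is_derive_lin_sum => k; exact: h.
Qed.

(** A local version, as the primitives below exist on bounded intervals only. *)
Lemma is_derive0_cst_near0 (f : R -> R) (T x : R) :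
  (forall y : R, `|y| < T -> is_derive y 1 f 0) -> `|x| < T -> f x = f 0.
Proof.
move=> df xT.
have key a b : a <= b -> (forall y, y \in `[a, b] -> `|y| < T) -> f b = f a.
  move=> ab abT; apply/eqP; rewrite -subr_eq0.
  have dab y : y \in `]a, b[ -> is_derive y 1 f 0.
    by move=> /subset_itv_oo_cc yab; apply: df; exact: abT.
  have [|c _ ->] := MVT_segment ab dab; last by rewrite mul0r.
  apply: continuous_in_subspaceT => y; rewrite inE /= => /abT /df [dfy _].
  exact/differentiable_continuous/derivable1_diffP.
move: xT; rewrite ltr_norml => xT.
have [x0|x0] := lerP 0 x.
  by apply: key => // y; rewrite in_itv /= ltr_norml; move: xT; lra.
apply/esym; apply: key => [|y]; first exact: ltW.
by rewrite in_itv /= ltr_norml; move: xT; lra.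
Qed.

Lemma is_derive0_mx_cst_near0 (p n : nat) (f : R -> 'M[R]_(p, n)) (T x : R) :
  (forall y : R, `|y| < T -> is_derive y 1 f 0) -> `|x| < T -> f x = f 0.
Proof.
move=> df xT; apply/matrixP => i j.
apply: (@is_derive0_cst_near0
  (fun y => f y i j) T) => // y /df /is_derive_mxP h.
by have := h i j; rewrite mxE.
Qed.

Lemma primitive_near0 (f : R -> R) (T : R) : continuous f ->
  exists F : R -> R, forall x : R, `|x| < T -> is_derive x 1 F (f x).
Proof.
move=> fc.
exists (fun x => \int[lebesgue_measure]_(t in [set` `[- T, x]]) (f t))%R.
move=> x; rewrite ltr_norml => /andP[Tx xT].
have [|dF dE] := @continuous_FTC1_closed R f (- T) x T xT _ Tx (fc x).
  apply: continuous_compact_integrable; first exact: segment_compact.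
  by apply: continuous_subspaceT => y; exact: fc.
by split; [exact: dF | rewrite -derive1E; exact: dE].
Qed.

Lemma primitive_mx_near0 (p n : nat) (f : R -> 'M[R]_(p, n)) (T : R) :
  continuous f ->
  exists F : R -> 'M[R]_(p, n), forall x : R, `|x| < T -> is_derive x 1 F (f x).
Proof.
move=> fc.
have prim i j : exists F : R -> R, forall x : R, `|x| < T ->
  is_derive x 1 F (f x i j).
  apply: primitive_near0 => x.
  apply: (@continuous_comp _ _ _ f (fun M : 'M[R]_(p, n) => M i j)).
    exact: fc.
  exact: coord_continuous.
exists (fun x => \matrix_(i, j) sval (cid (prim i j)) x) => x xT.
apply/is_derive_mxP => i j; under eq_fun do rewrite mxE.
exact: (svalP (cid (prim i j)) x xT).
Qed.

End MatrixDerivatives.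

(** * Lipschitz estimates from bounds on partial derivatives *)

Section Lipschitz.
Variable R : realType.

Section Box.
Variables (n : nat) (z0 : 'rV[R]_n) (r C : R) (f : 'rV[R]_n -> R)
  (g : 'I_n -> 'rV[R]_n -> R).
Hypothesis fg : forall z i, `|z - z0| < r ->
  is_derive z (delta_mx 0 i) f (g i z) /\ `|g i z| <= C.

(** The whole segment from [x] to [s *: e_i + x] stays in the ball because the
    norm is the supremum of the coordinates; the mean value theorem applies to
    it. *)
Lemma lipschitz_coord (x : 'rV[R]_n) i (s : R) :
  `|x - z0| < r -> `|s *: delta_mx 0 i + x - z0| < r ->
  `|f (s *: delta_mx 0 i + x) - f x| <= C * `|s|.
Proof.
move=> xr sxr.
pose p (t : R) := t *: delta_mx 0 i + x : 'rV[R]_n.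
have r0 : 0 < r by rewrite (le_lt_trans _ xr).
have pr t : Num.min 0 s <= t <= Num.max 0 s -> `|p t - z0| < r.
  move=> ts; apply: mx_norm_lt => // a j; rewrite /p !mxE ord1 eqxx /=.
  have := le_lt_trans (mx_norm_coord _ 0 j) xr.
  have := le_lt_trans (mx_norm_coord _ 0 j) sxr.
  rewrite !mxE eqxx /=; case: (j == i); last by rewrite !mulr0 add0r.
  rewrite !mulr1 !ltr_norml; move: ts; rewrite ge_min le_max.
  by case: (lerP 0 s) => s0 /andP[/orP[]] + /orP[]; lra.
have dp t : Num.min 0 s <= t <= Num.max 0 s ->
    is_derive t 1 (f \o p) (g i (p t)).
  move=> /pr /fg -/(_ i)[dfg _]; apply: is_derive_affine dfg => h.
  by rewrite /p scaler1 scalerDl addrA.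
have cp t : Num.min 0 s <= t <= Num.max 0 s -> {for t, continuous (f \o p)}.
  by move=> /dp[dfp _]; apply/differentiable_continuous/derivable1_diffP.
have E0 : f x = (f \o p) 0 by rewrite /p /= scale0r add0r.
have E1 : f (s *: delta_mx 0 i + x) = (f \o p) s by [].
have key (a b : R) : a <= b -> Num.min 0 s = a -> Num.max 0 s = b ->
    `|(f \o p) b - (f \o p) a| <= C * (b - a).
  move=> ab sa sb.
  have dp' t : t \in `]a, b[ -> is_derive t 1 (f \o p) (g i (p t)).
    by rewrite in_itv /= => /andP[? ?]; apply: dp; rewrite sa sb !ltW.
  have [|c cab ->] := MVT_segment ab dp'.
    apply: continuous_in_subspaceT => t; rewrite inE /= in_itv /= => tab.
    by apply: cp; rewrite sa sb.
  rewrite normrM [X in _ * X]ger0_norm ?subr_ge0 //.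
  rewrite ler_wpM2r ?subr_ge0 //; apply: (fg i _).2; apply: pr.
  by rewrite sa sb; move: cab; rewrite in_itv.
rewrite E0 E1; have [s0|s0] := lerP 0 s.
  by rewrite (ger0_norm s0); have := key 0 s s0; rewrite subr0; apply;
    [apply/min_idPl|apply/max_idPr].
rewrite (ltr0_norm s0) distrC; have := key s 0 (ltW s0); rewrite sub0r; apply.
  by apply/min_idPr/ltW.
by apply/max_idPl/ltW.
Qed.

(** Moving one coordinate at a time stays inside a ball for the supremum
    norm. *)
Lemma lipschitz_box (x y : 'rV[R]_n) : 0 <= C ->
  `|x - z0| < r -> `|y - z0| < r -> `|f x - f y| <= n%:R * C * `|x - y|.
Proof.
move=> C0 xr yr; have r0 : 0 < r by rewrite (le_lt_trans _ xr).
(* Interpolate from [y] to [x] by changing one coordinate at a time. *)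
pose z k : 'rV[R]_n := \row_j if (j < k)%N then x 0 j else y 0 j.
have zr k : `|z k - z0| < r.
  apply: mx_norm_lt => // a j; rewrite ord1 !mxE; case: ifP => _.
    by have := le_lt_trans (mx_norm_coord _ 0 j) xr; rewrite !mxE.
  by have := le_lt_trans (mx_norm_coord _ 0 j) yr; rewrite !mxE.
have zS (k : 'I_n) : z k.+1 = (x 0 k - y 0 k) *: delta_mx 0 k + z k.
  apply/rowP => j; rewrite !mxE eqxx /= ltnS leq_eqVlt (inj_eq val_inj).
  by case: eqVneq => [->|_] /=; rewrite ?ltnn ?mulr1 ?subrK ?mulr0 ?add0r.
have H k : (k <= n)%N -> `|f (z k) - f y| <= k%:R * C * `|x - y|.
  elim: k => [_|k IH kn].
    rewrite (_ : z 0%N = y) ?subrr ?normr0 ?mul0r //.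
    by apply/rowP => j; rewrite mxE.
  rewrite -[k.+1]addn1 natrD !mulrDl mul1r [leRHS]addrC.
  apply: le_trans (ler_distD (f (z k)) _ _) _; apply: lerD; last exact/IH/ltnW.
  rewrite addn1 (zS (Ordinal kn)); apply: le_trans (lipschitz_coord _ _) _.
  - exact: zr.
  - by rewrite -(zS (Ordinal kn)); exact: zr.
  - rewrite ler_wpM2l //.
    by have := mx_norm_coord (x - y) 0 (Ordinal kn); rewrite !mxE.
by have := H n (leqnn n); rewrite (_ : z n = x) //; apply/rowP => j;
  rewrite mxE ltn_ord.
Qed.

End Box.

Lemma row_mx_norm_lt (n p : nat) (x a : 'rV[R]_n) (y b : 'rV[R]_p) (r : R) :
  `|x - a| < r -> `|y - b| < r -> `|row_mx x y - row_mx a b| < r.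
Proof.
move=> xr yr; apply: mx_norm_lt => [|i j]; first exact: le_lt_trans xr.
rewrite opp_row_mx add_row_mx; case: (split_ordP j) => k ->.
  by rewrite row_mxEl; exact: le_lt_trans (mx_norm_coord _ _ _) xr.
rewrite row_mxEr; exact: le_lt_trans (mx_norm_coord _ _ _) yr.
Qed.

Lemma row_mx_norm0l (n p : nat) (y : 'rV[R]_p) : `|row_mx (0 :
  'rV[R]_n) y| <= `|y|.
Proof.
apply: mx_norm_le => // i j; case: (split_ordP j) => k ->.
  by rewrite row_mxEl mxE normr0.
by rewrite row_mxEr; exact: mx_norm_coord.
Qed.

Lemma row_mx_delta_l (n p : nat) (x : 'rV[R]_n) (y : 'rV[R]_p) (i :
  'I_n) (h : R) :
  row_mx (h *: delta_mx 0 i + x) y =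
  h *: delta_mx 0 (lshift p i) + row_mx x y.
Proof.
apply/rowP => j; case: (split_ordP j) => k ->; rewrite [RHS]mxE.
  by rewrite !row_mxEl !mxE (inj_eq (@lshift_inj _ _)).
by rewrite !row_mxEr !mxE eq_rlshift andbF mulr0 add0r.
Qed.

(** For fixed [y] and [y'] the partial derivatives of
    [x |-> f (x, y) - f (x, y')] are differences of partial derivatives of
    [f], to which the Lipschitz estimate applies in turn. The bound involves
    the second derivatives only, hence the product of the two increments. *)
Lemma mixed_difference_le (n p : nat) (f : 'rV[R]_(n + p) -> R)
    (g : 'I_(n + p) -> 'rV[R]_(n + p) -> R)
    (h : 'I_(n + p) -> 'I_(n + p) -> 'rV[R]_(n + p) -> R)
    (a : 'rV[R]_n) (b : 'rV[R]_p) (r C : R) :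
  0 <= C ->
  (forall z i, `|z - row_mx a b| < r -> is_derive z (delta_mx 0 i) f (g i z)) ->
  (forall z i j, `|z - row_mx a b| < r ->
     is_derive z (delta_mx 0 j) (g i) (h i j z) /\ `|h i j z| <= C) ->
  forall x x' y y', `|x - a| < r -> `|x' - a| < r -> `|y - b| < r ->
    `|y' - b| < r ->
  `|(f (row_mx x y) - f (row_mx x y')) - (f (row_mx x' y) - f (row_mx x' y'))|
    <= n%:R * ((n + p)%:R * C * `|y - y'|) * `|x - x'|.
Proof.
move=> C0 fg gh x x' y y' xr x'r yr y'r.
pose F (x : 'rV[R]_n) := f (row_mx x y) - f (row_mx x y').
pose G i (x : 'rV[R]_n) :=
  g (lshift p i) (row_mx x y) - g (lshift p i) (row_mx x y').
apply: (@lipschitz_box n a r _ F G) => // [z i zr|]; last by rewrite !mulr_ge0.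
have der w : `|w - b| < r ->
    is_derive z (delta_mx 0 i) (f \o (row_mx^~ w)) (g (lshift p i)
      (row_mx z w)).
  move=> wr; apply: (is_derive_affine (w := delta_mx 0 (lshift p i))).
    by move=> k; rewrite row_mx_delta_l.
  exact/fg/row_mx_norm_lt.
split.
  have := @is_deriveB _ _ _ _ _ _ _ _ _ (der y yr) (der y' y'r); exact.
rewrite /G; apply: le_trans (lipschitz_box (z0 := row_mx a b) (r := r) (g :=
  h (lshift p i)) _ C0 _ _) _.
- by move=> w j wr; exact: gh.
- exact: row_mx_norm_lt.
- exact: row_mx_norm_lt.
- apply: ler_wpM2l; first by rewrite mulr_ge0.
  by rewrite opp_row_mx add_row_mx subrr; exact: row_mx_norm0l.
Qed.

End Lipschitz.

(** * The group law in a chart *)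

Section ChartProduct.
Variables (R : realType) (d : nat) (G : lieGroupType R d) (phi : chart R d G).
Hypotheses (phi_atlas : atlas phi) (phi1 : chart_dom phi 1%g).

Let e := phi 1%g.

Definition chart_mul (x y : 'rV[R]_d) : 'rV[R]_d :=
  phi (chart_inv phi x * chart_inv phi y)%g.

Lemma chart_funK_dom g : chart_dom phi g -> chart_inv phi (phi g) = g.
Proof. by move=> /mem_set /(chart_funK (c := phi)). Qed.

Lemma chart_inv_continuous_at x : (phi @` chart_dom phi) x ->
  {for x, continuous (chart_inv phi)}.
Proof.
move=> px; have := chart_inv_continuous (c := phi).
rewrite continuous_open_subspace; last exact: chart_img_open.
by apply; exact/mem_set.
Qed.

Lemma chart_fun_continuous_at g : chart_dom phi g -> {for g, continuous phi}.
Proof.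
move=> pg; have := chart_fun_continuous (c := phi).
rewrite continuous_open_subspace; last exact: chart_dom_open.
by apply; exact/mem_set.
Qed.

Lemma chart_mul1r x : (phi @` chart_dom phi) x -> chart_mul x e = x.
Proof.
by move=> [g gd <-]; rewrite /chart_mul !chart_funK_dom // mulg1.
Qed.

(** The group law read in a chart around the identity. The second estimate is
    the mixed difference estimate between [y] and [e], since
    [chart_mul x e = x]. It is the factor [1 + C |y - e|], rather than a mere
    constant, that survives the iteration of the estimate. *)
Lemma chart_mul_lipschitz : exists r C : R, [/\ 0 < r, 1 <= C,
  forall x, `|x - e| < r -> (phi @` chart_dom phi) x,
  forall x y, `|x - e| < r -> `|y - e| < r ->
    chart_dom phi (chart_inv phi x * chart_inv phi y)%g &
  (forall x y y', `|x - e| < r -> `|y - e| < r -> `|y' - e| < r ->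
    `|chart_mul x y - chart_mul x y'| <= C * `|y - y'|) /\
  (forall x x' y, `|x - e| < r -> `|x' - e| < r -> `|y - e| < r ->
    `|chart_mul x y - chart_mul x' y| <= (1 + C * `|y - e|) * `|x - x'|)].
Proof.
pose F (z : 'rV[R]_(d + d)) :=
  (chart_inv phi (lsubmx z) * chart_inv phi (rsubmx z))%g.
pose U := [set z | [/\ (phi @` chart_dom phi) (lsubmx z),
                 (phi @` chart_dom phi) (rsubmx z) & chart_dom phi (F z)]].
have Fs : smooth_on U (phi \o F).
  by have := lie_mulg_smooth _ _ _ phi_atlas phi_atlas phi_atlas.
pose z0 := row_mx e e.
have ie : (phi @` chart_dom phi) e by exists 1%g.
have ne : nbhs e (phi @` chart_dom phi).
  by apply: open_nbhs_nbhs; split => //; exact: chart_img_open.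
have cl : {for z0, continuous (chart_inv phi \o @lsubmx R 1 d d)}.
  apply: continuous_comp; first exact: continuous_lsubmx.
  by apply: chart_inv_continuous_at; rewrite row_mxKl.
have cr : {for z0, continuous (chart_inv phi \o @rsubmx R 1 d d)}.
  apply: continuous_comp; first exact: continuous_rsubmx.
  by apply: chart_inv_continuous_at; rewrite row_mxKr.
have Fc : {for z0, continuous F}.
  apply: (@continuous_comp _ _ _ (fun z => (chart_inv phi (lsubmx z),
    chart_inv phi (rsubmx z)))
    (fun p => (p.1 * p.2)%g)); last exact: mulg_continuous.
  exact: (cvg_pair cl cr).
have nU : nbhs z0 U.
  have h1 : \forall z \near z0, (phi @` chart_dom phi) (lsubmx z).
    by apply: (continuous_lsubmx (p := d)); rewrite row_mxKl.
  have h2 : \forall z \near z0, (phi @` chart_dom phi) (rsubmx z).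
    by apply: (continuous_rsubmx (n := d)); rewrite row_mxKr.
  have h3 : \forall z \near z0, chart_dom phi (F z).
    apply: Fc; apply: open_nbhs_nbhs; split; first exact: chart_dom_open.
    by rewrite /F row_mxKl row_mxKr chart_funK_dom // mulg1.
  by near=> z; split; near: z.
have Uz0 : U z0 by exact: nbhs_singleton.
pose D1 i := 'D_(delta_mx 0 i) (phi \o F).
pose D2 i j := 'D_(delta_mx 0 j) (D1 i).
have [_ F2] := Fs 2%N.
have D1c z i : U z -> {for z, continuous (D1 i)}.
  by move=> Uz; have [_ [+ _]] := F2 i; exact.
have D2c z i j : U z -> {for z, continuous (D2 i j)}.
  by move=> Uz; have [_ [_ /(_ j)[_ [+ _]]]] := F2 i; exact.
have dF z i : U z -> derivable (phi \o F) z (delta_mx 0 i).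
  by have [+ _] := F2 i; exact.
have dD1 z i j : U z -> derivable (D1 i) z (delta_mx 0 j).
  by have [_ [_ /(_ j)[+ _]]] := F2 i; exact.
have [C1 C10 nC1] := near_bounded (fun i => D1c z0 i Uz0).
have [C2 C20 nC2] := near_bounded (fun ij :
  'I_(d + d) * 'I_(d + d) => D2c z0 ij.1 ij.2 Uz0).
have [r /= r0 rP] : exists2 r, 0 < r & forall z, `|z - z0| < r ->
    [/\ U z, forall i, `|D1 i z| <= C1 & forall ij, `|D2 ij.1 ij.2 z| <= C2].
  have : \forall z \near z0, [/\ U z, forall i, `|D1 i z| <= C1 & forall ij,
    `|D2 ij.1 ij.2 z| <= C2].
    by near=> z; split; near: z.
  move=> /nbhs_ballP[r /= r0 rP]; exists r => // z zr; apply: rP.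
  by rewrite -ball_normE /= distrC.
have bP x y : `|x - e| < r -> `|y - e| < r -> `|row_mx x y - z0| < r.
  exact: row_mx_norm_lt.
have muE x y : chart_mul x y = (phi \o F) (row_mx x y).
  by rewrite /chart_mul /= /F row_mxKl row_mxKr.
have ee : `|e - e| < r by rewrite subrr normr0.
exists r, (1 + (d + d)%:R * C1 + d%:R * ((d + d)%:R * C2)).
split => //.
- by rewrite -addrA lerDl addr_ge0 // !mulr_ge0.
- by move=> x xr; have [[+ _ _] _ _] := rP _ (bP _ _ xr ee); rewrite row_mxKl.
- move=> x y xr yr; have [[_ _ +] _ _] := rP _ (bP _ _ xr yr).
  by rewrite /F row_mxKl row_mxKr.
split.
  move=> x y y' xr yr y'r; apply: mx_norm_le => [|i c].
    by rewrite mulr_ge0 // ?addr_ge0 // !mulr_ge0.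
  rewrite !mxE !muE ord1.
  apply: le_trans (lipschitz_box (z0 := z0) (r := r) (C := C1)
    (f := fun z => (phi \o F) z 0 c) (g :=
      fun i z => D1 i z 0 c) _ C10 (bP _ _ xr yr) (bP _ _ xr y'r)) _.
    move=> z k /rP[Uz D1z _]; split; first exact: is_derive_coord (dF _ _ Uz).
    exact: le_trans (mx_norm_coord _ _ _) (D1z k).
  apply: ler_pM => //; first by rewrite mulr_ge0.
    by rewrite addrAC lerDr addr_ge0 // !mulr_ge0.
  by rewrite opp_row_mx add_row_mx subrr; exact: row_mx_norm0l.
move=> x x' y xr x'r yr; apply: mx_norm_le => [|i c].
  by rewrite mulr_ge0 // addr_ge0 // mulr_ge0 // ?addr_ge0 // !mulr_ge0.
have imx z : `|z - e| < r -> chart_mul z e = z.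
  move=> zr; apply: chart_mul1r.
  by have [[+ _ _] _ _] := rP _ (bP _ _ zr ee); rewrite row_mxKl.
rewrite ord1 mulrDl mul1r.
pose f z := (phi \o F) z 0 c.
have := @mixed_difference_le R d d f (fun i z => D1 i z 0 c)
  (fun i j z => D2 i j z 0 c)
  e e r C2 C20 _ _ x x' y e xr x'r yr ee.
rewrite /f -!muE (imx x xr) (imx x' x'r) => mix.
have {mix} := mix _ _.
set A := (chart_mul x y) 0 c; set B := (chart_mul x' y) 0 c.
move=> mix; have {}mix : `|A - x 0 c - (B - x' 0 c)| <=
    d%:R * ((d + d)%:R * C2 * `|y - e|) * `|x - x'|.
  apply: mix => [z k /rP[Uz _ _]|z k l /rP[Uz _ D2z]].
    exact: is_derive_coord (dF _ _ Uz).
  split; first exact: is_derive_coord (dD1 _ _ _ Uz).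
  exact: le_trans (mx_norm_coord _ _ _) (D2z (k, l)).
rewrite !mxE -/A -/B.
rewrite (_ : A - B = (x 0 c - x' 0 c) + (A - x 0 c - (B - x' 0 c)));
  last by ring.
apply: le_trans (ler_normD _ _) _; apply: lerD.
  by have := mx_norm_coord (x - x') 0 c; rewrite !mxE.
apply: le_trans mix _; rewrite -mulrA; rewrite -!mulrA !mulrA.
apply: ler_wpM2r => //; apply: ler_wpM2r => //.
by rewrite -mulrA lerDr addr_ge0 // mulr_ge0.
Unshelve. all: by end_near. Qed.

End ChartProduct.

(** * Continuity of the exponential map *)

Section ExpContinuous.
Variables (R : realType) (d : nat) (G : lieGroupType R d) (phi : chart R d G).
Variable expG : 'rV[R]_d -> G.
Hypotheses (phi_atlas : atlas phi) (phi1 : chart_dom phi 1%g).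
Hypothesis expGP : exponential_map phi expG.

Let e := phi 1%g.
Let c (X : 'rV[R]_d) (t : R) := phi (expG (t *: X)).

Lemma exp0 : expG 0 = 1%g.
Proof.
have [[_ h] _] := expGP 0; have := h 0 0; rewrite addr0 scale0r => hh.
by apply: (mulIg (expG 0)); rewrite mul1g.
Qed.

Lemma exp_multiple X (k : nat) : expG (k%:R *: X) = (expG X ^+ k)%g.
Proof.
elim: k => [|k IH]; first by rewrite scale0r exp0 expg0.
have [[_ h] _] := expGP X.
by rewrite -[k.+1]addn1 natrD h IH scale1r expgnDr expg1.
Qed.

(** The initial velocity of [t |-> exp (tX)], sampled at the times
    [1 / (N + 1)] that serve as step lengths below. *)
Lemma exp_chart_small X (eps : R) : 0 < eps ->
  \forall N \near \oo,
    chart_dom phi (expG (N.+1%:R^-1 *: X)) /\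
    `|c X N.+1%:R^-1 - e - N.+1%:R^-1 *: X| <= N.+1%:R^-1 * eps.
Proof.
move=> eps0; have [[cX _] dX] := expGP X.
have nd : \forall h \near (0 : R), chart_dom phi (expG (h *: X)).
  apply: (cX 0); apply: open_nbhs_nbhs; split; first exact: chart_dom_open.
  by rewrite scale0r exp0.
have [dd dE] := dX.
have : (fun h : R => h^-1 *: (c X (h *: 1 + 0) - c X 0)) @ 0^' --> X.
  by rewrite -[X in _ --> X]dE; exact: dd.
move=> /cvgrPdist_le /(_ eps eps0) /= nd2.
have {nd2} : \forall h \near (0 : R), h != 0 ->
  `|X - h^-1 *: (c X (h *: 1 + 0) - c X 0)| <= eps.
  exact: nd2.
move=> nd2; have : \forall h \near (0 : R), chart_dom phi (expG (h *: X)) /\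
  (h != 0 -> `|X - h^-1 *: (c X (h *: 1 + 0) - c X 0)| <= eps).
  by near=> h; split; near: h.
move=> /nbhs_ballP[r /= r0 rP].
near=> N.
have N0 : 0 < N.+1%:R^-1 :> R by rewrite invr_gt0.
have [|h1 h2] := rP N.+1%:R^-1.
  rewrite -ball_normE /= sub0r normrN gtr0_norm //.
  by near: N; exact: (near_infty_natSinv_lt (PosNum r0)).
split => //; have {}h2 := h2 (lt0r_neq0 N0).
rewrite addr0 in h2.
rewrite (_ : c X _ - e - _ = - (N.+1%:R^-1 *: (X - N.+1%:R^-1^-1 *: (c X
  (N.+1%:R^-1 *: 1) - c X 0)))).
  by rewrite normrN normrZ gtr0_norm // ler_pM2l.
rewrite scalerBr scalerA mulfV ?lt0r_neq0 // scale1r opprB /c scale0r exp0 -/e.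
by rewrite -[_ *: 1]/(_ * 1) mulr1.
Unshelve. all: by end_near. Qed.

(** Discrete Gronwall inequality for the powers of [exp (X / N)] and
    [exp (Y / N)]: each multiplication increases the distance by a factor
    [1 + 1/N] and adds an error of order [|X - Y| / N]. The expansion at 0 is
    applied to two fixed vectors, and [N] is chosen after them. *)
Lemma chart_exp_lipschitz : exists delta K : R, 0 < delta /\
  forall X Y, `|X| < delta -> `|Y| < delta ->
   [/\ chart_dom phi (expG X), chart_dom phi (expG Y) &
    `|phi (expG X) - phi (expG Y)| <= K * `|X - Y|].
Proof.
have [r [C [r0 C1 rdom rmul [muy mux]]]] := chart_mul_lipschitz phi_atlas phi1.
have C0 : 0 < C by rewrite (lt_le_trans _ C1).
(* [delta] keeps the first [N] powers in the ball and makes the growth factor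
   of one step at most [1 + h]. *)
pose delta := Num.min (1 / C) (r / C) / 4.
have delta0 : 0 < delta by rewrite divr_gt0 // lt_min !divr_gt0.
have Cd4 a : Num.min (1 / C) (r / C) <= a / C -> C * (4 * delta) <= a.
  by move=> ?; rewrite /delta [4 * _]mulrC divfK // mulrC -ler_pdivlMr.
have Cd1 : C * (2 * delta) <= 1.
  have : C * (4 * delta) <= 1 by apply: Cd4; rewrite ge_min lexx.
  have : 0 < C * delta by rewrite mulr_gt0.
  by lra.
have Cdr : C * (2 * delta) < r.
  have : C * (4 * delta) <= r by apply: Cd4; rewrite ge_min lexx orbT.
  have : 0 < C * delta by rewrite mulr_gt0.
  by lra.
exists delta, (expR 1 * C); split => // X Y Xd Yd.
have key eps : 0 < eps -> eps < delta ->
    [/\ chart_dom phi (expG X), chart_dom phi (expG Y) &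
     `|phi (expG X) - phi (expG Y)| <= expR 1 * C * (`|X - Y| + 2 * eps)].
  move=> eps0 epsd.
  have : \forall N \near \oo,
    (chart_dom phi (expG (N.+1%:R^-1 *: X)) /\
     `|c X N.+1%:R^-1 - e - N.+1%:R^-1 *: X| <= N.+1%:R^-1 * eps) /\
    (chart_dom phi (expG (N.+1%:R^-1 *: Y)) /\
     `|c Y N.+1%:R^-1 - e - N.+1%:R^-1 *: Y| <= N.+1%:R^-1 * eps).
    by apply: filterI; exact: exp_chart_small.
  move=> [N _ /(_ N (leqnn N))[]].
  set h := N.+1%:R^-1 : R; move=> XN YN.
  have h0 : 0 < h by rewrite invr_gt0.
  have hN : h * N.+1%:R = 1 by rewrite mulVf.
  have NhE Z : expG Z = expG ((N.+1%:R * h) *: Z) by rewrite mulrC hN scale1r.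
  have step Z : `|Z| < delta -> `|c Z h - e - h *: Z| <= h * eps ->
      `|c Z h - e| <= h * (2 * delta).
    move=> Zd Zh; rewrite -[c Z h - e](subrK (h *: Z)).
    apply: le_trans (ler_normD _ _) _; rewrite normrZ gtr0_norm //.
    have : h * `|Z| <= h * delta by rewrite ler_pM2l // ltW.
    have : h * eps <= h * delta by rewrite ler_pM2l // ltW.
    by lra.
  have h1 : h <= 1 by rewrite invf_le1 // ler1n.
  have stepr Z : `|Z| < delta -> `|c Z h - e - h *: Z| <= h * eps ->
      `|c Z h - e| < r.
    move=> Zd Zh; apply: le_lt_trans (step Z Zd Zh) _.
    apply: le_lt_trans Cdr; apply: ler_pM => //; [exact: ltW | lra|].
    exact: le_trans C1.
  have er : `|e - e| < r by rewrite subrr normr0.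
  have addk Z k : expG ((k.+1%:R * h) *: Z) = (expG ((k%:R * h) *: Z) * expG
    (h *: Z))%g.
    have [[_ hom] _] := expGP Z.
    by rewrite -[k.+1]addn1 natrD mulrDl mul1r hom.
  (* The powers of [exp (h *: Z)] do not leave the ball, by induction: the
     total displacement is at most [C * (2 * delta) < r]. *)
  have inside Z : `|Z| < delta -> chart_dom phi (expG (h *: Z)) ->
      `|c Z h - e - h *: Z| <= h * eps ->
      forall k, (k <= N.+1)%N -> [/\ chart_dom phi (expG ((k%:R * h) *: Z)),
        `|c Z (k%:R * h) - e| <= k%:R * h * (C * (2 * delta)),
        `|c Z (k%:R * h) - e| < r &
        c Z (k.+1%:R * h) = chart_mul phi (c Z (k%:R * h)) (c Z h)].
    move=> Zd Zdom Zh.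
    have lastP k : (k <= N.+1)%N -> chart_dom phi (expG ((k%:R * h) *: Z)) ->
        `|c Z (k%:R * h) - e| <= k%:R * h * (C * (2 * delta)) ->
        [/\ chart_dom phi (expG ((k%:R * h) *: Z)),
          `|c Z (k%:R * h) - e| <= k%:R * h * (C * (2 * delta)),
          `|c Z (k%:R * h) - e| < r &
          c Z (k.+1%:R * h) = chart_mul phi (c Z (k%:R * h)) (c Z h)].
      move=> kN kdom kle; split => //.
        apply: le_lt_trans kle _; apply: le_lt_trans Cdr.
        have kh1 : k%:R * h <= 1.
          apply: (@le_trans _ _ (N.+1%:R * h));
            first by rewrite ler_pM2r // ler_nat.
          by rewrite mulrC hN.
        rewrite -[leRHS]mul1r; apply: ler_wpM2r => //.
        by rewrite mulr_ge0 ?(ltW C0) // mulr_ge0 // ltW.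
      by rewrite /chart_mul /c !chart_funK_dom // addk.
    elim => [_|k IH kN].
      apply: lastP => //; first by rewrite mul0r scale0r exp0.
      by rewrite /c !mul0r scale0r exp0 subrr normr0.
    have [kdom kle kr kE] := IH (ltnW kN).
    have SE : expG ((k.+1%:R * h) *: Z) =
        (chart_inv phi (c Z (k%:R * h)) * chart_inv phi (c Z h))%g.
      by rewrite addk /c !chart_funK_dom.
    apply: lastP => //; first by rewrite SE; apply: rmul => //; exact: stepr.
    have stepk : `|c Z (k.+1%:R * h) - c Z (k%:R * h)| <= h * (C * (2 * delta)).
      rewrite kE -{2}(chart_mul1r phi1 (rdom _ kr)).
      apply: le_trans (muy _ _ _ kr (stepr _ Zd Zh) er) _.
      by rewrite [leRHS]mulrCA ler_pM2l //; exact: step.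
    have -> : k.+1%:R * h * (C * (2 * delta)) =
        h * (C * (2 * delta)) + k%:R * h * (C * (2 * delta)).
      by rewrite -[k.+1]addn1 natrD; ring.
    by apply: le_trans (ler_distD (c Z (k%:R * h)) _ _) _; apply: lerD.
  have insX := inside X Xd XN.1 XN.2; have insY := inside Y Yd YN.1 YN.2.
  have [Xdom _ _ _] := insX _ (leqnn _); have [Ydom _ _ _] := insY _ (leqnn _).
  rewrite -NhE in Xdom; rewrite -NhE in Ydom; split => //.
  pose B := C * (`|X - Y| + 2 * eps).
  have B0 : 0 <= B by rewrite mulr_ge0 ?(ltW C0) // addr_ge0 // mulr_ge0 // ltW.
  have XYh : C * `|c X h - c Y h| <= h * B.
    rewrite /B mulrCA ler_pM2l //.
    rewrite (_ : c X h - c Y h = h *: (X - Y) + ((c X h - e - h *: X) -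
      (c Y h - e - h *: Y))).
      apply: le_trans (ler_normD _ _) _; rewrite normrZ gtr0_norm // mulrDr.
      apply: lerD => //; apply: le_trans (ler_normB _ _) _.
      by have := XN.2; have := YN.2; lra.
    apply/rowP => j; rewrite !mxE; ring.
  have dist k : (k <= N.+1)%N ->
      `|c X (k%:R * h) - c Y (k%:R * h)| <= (1 + h) ^+ k * (k%:R * (h * B)).
    elim: k => [_|k IH kN];
      first by rewrite /c !mul0r !scale0r subrr normr0 mulr0.
    have [_ _ Xr ->] := insX _ (ltnW kN); have [_ _ Yr ->] := insY _ (ltnW kN).
    apply: le_trans (ler_distD (chart_mul phi (c Y (k%:R * h)) (c X h)) _ _) _.
    have Xhr := stepr _ Xd XN.2; have Yhr := stepr _ Yd YN.2.
    have m1 := mux _ _ _ Xr Yr Xhr.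
    have m2 := muy _ _ _ Yr Xhr Yhr.
    have hk : 1 <= (1 + h) ^+ k by apply: exprn_ege1; rewrite lerDl ltW.
    have m3 : (1 + C * `|c X h - e|) * `|c X (k%:R * h) - c Y (k%:R * h)| <=
       (1 + h) * ((1 + h) ^+ k * (k%:R * (h * B))).
      apply: ler_pM => //; first by rewrite addr_ge0 // mulr_ge0 // ltW.
        rewrite lerD2l; apply: le_trans (_ : C * (h * (2 * delta)) <= _).
          by rewrite ler_pM2l //; exact: step Xd XN.2.
        by rewrite mulrCA -[leRHS]mulr1 ler_pM2l.
      exact: IH (ltnW kN).
    have m4 : h * B <= (1 + h) ^+ k.+1 * (h * B).
      rewrite -[leLHS]mul1r; apply: ler_wpM2r; first by rewrite mulr_ge0 // ltW.
      by apply: exprn_ege1; rewrite lerDl ltW.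
    have -> : (1 + h) ^+ k.+1 * (k.+1%:R * (h * B)) =
        (1 + h) * ((1 + h) ^+ k * (k%:R * (h * B))) + (1 + h) ^+ k.+1 * (h * B).
      by rewrite -natr1 exprS; ring.
    move: m1 m2 m3 m4 XYh; lra.
  rewrite {1}NhE {1}(NhE Y); apply: le_trans (dist _ (leqnn _)) _.
  rewrite [_.+1%:R * _]mulrA [_.+1%:R * h]mulrC hN mul1r -mulrA;
    apply: ler_wpM2r => //.
  apply: le_trans (_ : expR h ^+ N.+1 <= _); last first.
    by rewrite -expRM_natl mulrC hN.
  by apply: lerXn2r; rewrite ?nnegrE ?expR_ge0 ?addr_ge0 ?expR_ge1Dx // ltW.
have [? ? _] := key (delta / 2) ltac:(lra) ltac:(lra).
split => //; apply/ler_addgt0Pr => eps eps0.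
pose eta := Num.min (delta / 2) (eps / (expR 1 * C * 2)).
have E0 : 0 < expR 1 * C :> R by rewrite mulr_gt0 // expR_gt0.
have eta0 : 0 < eta 
  by rewrite lt_min; apply/andP; split; [lra | rewrite divr_gt0 // mulr_gt0].
have etad : eta < delta.
  by rewrite gt_min; apply/orP; left; lra.
have [_ _ /le_trans] := key eta eta0 etad; apply.
rewrite mulrDr lerD2l mulrA -ler_pdivlMl ?mulr_gt0 //.
by rewrite mulrC /eta ge_min lexx orbT.
Qed.

Lemma continuous_expg_nat (k : nat) : continuous (fun g : G => (g ^+ k)%g).
Proof.
elim: k => [|k IH] g; first by under eq_fun do rewrite expg0; exact: cvg_cst.
under eq_fun do rewrite expgS.
apply: (@continuous_comp _ _ _ (fun g :
  G => (g, (g ^+ k)%g)) (fun p => (p.1 * p.2)%g)).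
  by apply: cvg_pair; [exact: cvg_id | exact: IH].
exact: mulg_continuous.
Qed.

Lemma continuous_exp_small : exists2 delta : R, 0 < delta &
  forall X, `|X| < delta -> {for X, continuous expG}.
Proof.
have [delta [K [delta0 XY]]] := chart_exp_lipschitz.
exists delta => // X Xd.
have near_small : \forall Y \near X, `|Y| < delta.
  have := near_dist_lt X (_ : 0 < delta - `|X|); rewrite subr_gt0 => /(_ Xd).
  apply: filterS => Y; rewrite distrC => YX.
  have := ler_normD (Y - X) X; rewrite subrK; lra.
have Xdom : chart_dom phi (expG X) by have [] := XY X X Xd Xd.
have cphi : {for X, continuous (phi \o expG)}.
  apply/(@cvgrPdist_lt _ _ _ _ (nbhs_filter (X : 'rV[R]_d))) => eps eps0;
    near=> Y.
  have Yd : `|Y| < delta by near: Y.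
  have [_ _ /le_lt_trans] := XY X Y Xd Yd; apply.
  have Kp : 0 < `|K| + 1 by rewrite ltr_wpDl.
  apply: (@le_lt_trans _ _ ((`|K| + 1) * `|X - Y|)).
    by apply: ler_wpM2r => //; have := ler_norm K; lra.
  rewrite -ltr_pdivlMl //; near: Y; apply: (@near_dist_lt R 'rV[R]_d X).
  by rewrite mulr_gt0 // invr_gt0.
have E : \forall Y \near X, (chart_inv phi \o (phi \o expG)) Y = expG Y.
  near=> Y; have Yd : `|Y| < delta by near: Y.
  by rewrite /= chart_funK_dom //; have [] := XY X Y Xd Yd.
have c2 : {for X, continuous (chart_inv phi \o (phi \o expG))}.
  apply: continuous_comp => //; apply: chart_inv_continuous_at.
  by exists (expG X).
rewrite /prop_for /continuous_at -(chart_funK_dom Xdom).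
exact: (cvg_trans (near_eq_cvg E) c2).
Unshelve. all: by end_near. Qed.

(** The identity [exp X = exp (X / N) ^ N] carries continuity from a
    neighborhood of the origin to the whole Lie algebra. *)
Lemma continuous_exp : continuous expG.
Proof.
have [delta delta0 small] := continuous_exp_small.
move=> X.
have [N NX] : exists N : nat, `|N.+1%:R^-1 *: X| < delta.
  have Xp : 0 < `|X| + 1 by rewrite ltr_wpDl.
  have [N _ /(_ N (leqnn N)) NP] :=
    near_infty_natSinv_lt (PosNum (divr_gt0 delta0 Xp)).
  exists N; rewrite normrZ gtr0_norm ?invr_gt0 //.
  move: NP => /=; rewrite ltr_pdivlMr //; apply: le_lt_trans.
  by rewrite ler_pM2l ?invr_gt0 // lerDl.
have E : (fun g : G => (g ^+ N.+1)%g) \o (expG \o *:%R N.+1%:R^-1) = expG.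
  by apply/funext => Y /=; rewrite -exp_multiple scalerA mulfV // scale1r.
suff : {for X, continuous ((fun g :
  G => (g ^+ N.+1)%g) \o (expG \o *:%R N.+1%:R^-1))}.
  by rewrite E.
apply: continuous_comp; last exact: continuous_expg_nat.
apply: continuous_comp; last exact: small.
exact: scaler_continuous.
Qed.

End ExpContinuous.

(** * Periodic solutions of triangular linear systems *)

Section LinearSystems.
Variable R : realType.

(** Averaging over a short interval: the matrix [M = P s - P 0], with [P] a
    primitive of [U], is invertible for small [s], and
    [U t *m M = P (t + s) - P t] is differentiable in [t]. *)
Lemma one_parameter_mx_derivable (m : nat) (U : R -> 'M[R]_m) :
  continuous U -> U 0 = 1%:M -> (forall s t, U (s + t) = U s *m U t) ->
  derivable U 0 1.
Proof.
move=> Uc U0 UD.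
have [P PU] := primitive_mx_near0 2 Uc.
have avg t s : `|t| < 1 -> `|s| < 1 -> U t *m (P s - P 0) = P (s + t) - P t.
  move=> t1 s1.
  pose Q s := P (s + t) - U t *m P s.
  have : Q s = Q 0.
    apply: is_derive0_mx_cst_near0 s1 => y y1.
    have -> : 0 = U (y + t) - U t *m U y by rewrite [y + t]addrC UD subrr.
    apply: is_deriveB.
      apply: is_derive_comp_addr; apply: PU.
      by apply: le_lt_trans (ler_normD _ _) _; lra.
    by apply: is_derive_mulmxl; apply: PU; lra.
  rewrite /Q add0r mulmxBr => /eqP; rewrite subr_eq => /eqP ->.
  by rewrite addrAC [P t - _]addrC addrK addrC.
have [s s1 sM] : exists2 s, `|s| < 1 & P s - P 0 \in unitmx.
  have dP0 : is_derive (0:R) 1 P (U 0) by apply: PU; rewrite normr0.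
  have cvP i j : (fun h : R => (h^-1 *: (P h - P 0)) i j) @ 0^' --> (U 0) i j.
    have /is_derive_mxP/(_ i j)[dij <-] := dP0.
    have -> : (fun h : R => (h^-1 *: (P h - P 0)) i j) =
        (fun h => h^-1 *: ((fun x => P x i j) (h *: 1 + 0) - P 0 i j)).
      apply/funext => h; rewrite addr0 -[h *: 1]/(h * 1) mulr1.
      by rewrite !mxE.
    exact: dij.
  have detc : (fun h : R => \det (h^-1 *: (P h - P 0))) @ 0^' --> (1 : R).
    by rewrite -(det1 R m) -U0; exact: cvg_det cvP.
  move/cvgrPdist_lt : detc => /(_ 1 ltr01) nd.
  have : \forall h \near (0:R)^',
    h != 0 /\ (`|h| < 1 /\ `|1 - \det (h^-1 *: (P h - P 0))| < 1).
    near=> h; split; first by near: h; exact: nbhs_dnbhs_neq.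
    by split; near: h => //; exact: dnbhs0_lt.
  move=> /filter_ex[h [h0 [h1 dh]]]; exists h => //.
  rewrite unitmxE unitfE; apply/eqP => d0.
  by move: dh; rewrite detZ d0 mulr0 subr0 normr1 ltxx.
pose g t := (P (t + s) - P t) *m invmx (P s - P 0).
have nE : \forall t \near (0:R), g t = U t.
  have n1 : \forall t \near (0:R), `|t| < 1.
    by apply: (filterS _ (near_dist_lt (0 : R) ltr01)) => t;
      rewrite sub0r normrN.
  near=> t; have t1 : `|t| < 1 by near: t.
  rewrite /g [t + s]addrC -avg //.
  by rewrite -mulmxA mulmxV // mulmx1.
apply: near_eq_derivable nE _.
suff [] : is_derive (0 : R) 1 g ((U (0 + s) - U 0) *m invmx (P s - P 0)) by [].
apply: is_derive_mulmxr; apply: is_deriveB.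
  by apply: is_derive_comp_addr; apply: PU; rewrite add0r; lra.
by apply: PU; rewrite normr0.
Unshelve. all: by end_near. Qed.

Lemma one_parameter_mx_derive (m : nat) (U : R -> 'M[R]_m) (t : R) :
  continuous U -> U 0 = 1%:M -> (forall s t, U (s + t) = U s *m U t) ->
  is_derive t 1 U (derive1 U 0 *m U t).
Proof.
move=> Uc U0 UD.
have dU0 : is_derive (0 : R) 1 U (derive1 U 0).
  by split; [exact: one_parameter_mx_derivable | rewrite derive1E].
have UE : (fun s => U (s + (- t)) *m U t) = U.
  by apply/funext => s; rewrite -UD subrK.
have h : is_derive t 1 (fun s => U (s + (- t))) (derive1 U 0).
  by apply: (is_derive_comp_addr (f := U)); rewrite subrr.
by have := is_derive_mulmxr (U t) h; rewrite UE.
Qed.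

Lemma sub_daddv_pi_compl (K : fieldType) (vT : vectType K) (V : {vspace vT}) x :
  x - daddv_pi V^C V x \in V.
Proof.
have dis : (V^C :&: V = 0)%VS by rewrite capvC capv_compl.
have full : x \in (V^C + V)%VS by rewrite addvC addv_complf memvf.
have E := daddv_pi_add dis full.
have -> : x - daddv_pi V^C V x = daddv_pi V V^C x.
  by apply/eqP; rewrite subr_eq addrC E.
exact: memv_pi.
Qed.

Lemma daddv_pi_compl_eq0 (K : fieldType) (vT : vectType K) (V : {vspace vT}) x :
  (daddv_pi V^C V x == 0) = (x \in V).
Proof.
apply/eqP/idP => [p0|xV]; first by rewrite -[x]subr0 -p0 sub_daddv_pi_compl.
apply/eqP; rewrite -memv0 -(capv_compl V) memv_cap memv_pi andbT.
by rewrite -(subKr x (daddv_pi _ _ x)) memvB // sub_daddv_pi_compl.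
Qed.

(** A coordinate of the projection onto a complement of [V], chosen so as not
    to vanish on [W]. *)
Lemma flag_functional (F : fieldType) (m : nat) (V W : {vspace 'cV[F]_m}) :
  (V <= W)%VS -> \dim W = (\dim V).+1 ->
  exists phi : 'rV[F]_m, (forall x, x \in V -> phi *m x = 0) /\
    (forall y, y \in W -> phi *m y = 0 -> y \in V).
Proof.
move=> VW dimW.
have [x xW xV] : exists2 x, x \in W & x \notin V.
  by apply/subvPn; apply/negP => /dimvS; rewrite dimW ltnn.
pose p := daddv_pi V^C V.
have [k xk] : exists k, p x k 0 != 0.
  apply: contrapT => px0; move/negP: xV; apply; rewrite -daddv_pi_compl_eq0.
  apply/eqP/colP => k; rewrite mxE; apply: contrapT => /eqP xk.
  by apply: px0; exists k.
pose phi : 'rV[F]_m := \row_j p (delta_mx j 0) k 0.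
have phiE y : (phi *m y) 0 0 = p y k 0.
  have yE : y = \sum_j y j 0 *: delta_mx j 0.
    by rewrite {1}(matrix_sum_delta y); apply: eq_bigr => j _; rewrite big_ord1.
  rewrite {2}yE mxE.
  rewrite linear_sum summxE; apply: eq_bigr => j _.
  by rewrite linearZ !mxE mulrC.
exists phi; split=> [y|y yW py].
  rewrite -daddv_pi_compl_eq0 => /eqP py.
  by apply/matrixP => i j; rewrite !ord1 phiE /p py !mxE.
have : y \in (V + <[x]>)%VS.
  suff -> : (V + <[x]>)%VS = W by [].
  apply/eqP; rewrite eqEdim subv_add VW -memvE xW dimW /=.
  apply: contraNT xV; rewrite -leqNgt memvE => dle.
  have /eqP -> : V == (V + <[x]>)%VS by rewrite eqEdim addvSl.
  exact: addvSr.
move=> /memv_addP[v vV [_ /vlineP[a ->] yE]].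
have pv : p v = 0 by apply/eqP; rewrite daddv_pi_compl_eq0.
have pyE : p y = a *: p x by rewrite yE linearD /= linearZ /= pv add0r.
have := phiE y; rewrite py pyE !mxE => /esym/eqP.
by rewrite mulf_eq0 (negbTE xk) orbF yE => /eqP ->; rewrite scale0r addr0.
Qed.

Lemma mulmx_complexE (m : nat) (phi : 'rV[R[i]]_m) (w : 'cV[R]_m) :
  (phi *m map_mx (real_complex R) w) 0 0 =
  Complex ((map_mx (@complex.Re R) phi *m w) 0 0) ((map_mx
    (@complex.Im R) phi *m w) 0 0).
Proof.
rewrite !mxE; elim/big_rec3: _ => // k a b c _ ->.
rewrite !mxE; case: (phi 0 k) => x y; apply/eqP; rewrite eq_complex /=.
by apply/andP; split; apply/eqP; ring.
Qed.

(** The functions [p] and [q] are the real and imaginary parts of a solution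
    of [z' = g (1 + ic) z], whose squared modulus grows like [exp (2 g t)]. *)
Lemma periodic_growth_zero (p q : R -> R) (g c : R) :
  (forall t : R, is_derive t 1 p (g * (p t - c * q t))) ->
  (forall t : R, is_derive t 1 q (g * (q t + c * p t))) ->
  (forall t, p (t + 1) = p t) -> (forall t, q (t + 1) = q t) ->
  g != 0 -> forall t, p t = 0 /\ q t = 0.
Proof.
move=> dp dq p1 q1 g0.
pose E t := expR (- (2 * g) * t).
have dE (t : R) : is_derive t 1 E (- (2 * g) * E t).
  rewrite mulrC /E.
  apply: is_derive1_comp.
  have := @is_deriveZ R R R id (- (2 * g)) t 1 1 _.
  by rewrite -[_ *: 1]/(_ * 1) mulr1; apply.
(* [|z|^2 exp (- 2 g t)] is constant. *)
pose N : R -> R := (p * p + q * q) * E.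
have NE t : N t = (p t ^+ 2 + q t ^+ 2) * E t by [].
have dN (t : R) : is_derive t 1 N 0.
  have h := is_deriveM (is_deriveD (is_deriveM (dp t) (dp t)) (is_deriveM
    (dq t) (dq t))) (dE t).
  apply: (is_derive_eq h).
  rewrite /GRing.scale /= -[X in X * _ + _]/(p t * p t + q t * q t).
  by ring.
have N01 : N 0 = N 1 by exact: is_derive_0_is_cst.
have E1 : E 1 != E 0.
  rewrite /E mulr0 mulr1; apply/eqP => /expR_inj/eqP.
  by rewrite oppr_eq0 mulf_eq0 (negbTE g0) orbF pnatr_eq0.
have N0 : p 0 ^+ 2 + q 0 ^+ 2 = 0.
  move: N01; rewrite !NE -[1]add0r p1 q1 !add0r => /eqP;
    rewrite -subr_eq0 -mulrBr mulf_eq0.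
  by rewrite subr_eq0 [E 0 == _]eq_sym (negbTE E1) orbF => /eqP.
move=> t; have : N t = 0 by rewrite (is_derive_0_is_cst t 0 dN) NE N0 mul0r.
rewrite NE => /eqP; rewrite mulf_eq0 (gt_eqF (expR_gt0 _)) orbF.
by rewrite paddr_eq0 ?sqr_ge0 // !sqrf_eq0 => /andP[/eqP -> /eqP ->].
Qed.

(** A constant velocity moves a periodic function only if it is zero. *)
Lemma constant_primitive_periodic (p P : R -> R) :
  (forall t : R, is_derive t 1 p 0) -> (forall t : R, is_derive t 1 P (p t)) ->
  P 1 = P 0 -> forall t, p t = 0.
Proof.
move=> dp dP P1 t.
have [|c _] := MVT_segment ler01 (fun x _ => dP x).
  apply: continuous_subspaceT => x; have [dPx _] := dP x.
  exact/differentiable_continuous/derivable1_diffP.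
rewrite P1 subrr subr0 mulr1 => pc.
by rewrite (is_derive_0_is_cst t c dp).
Qed.

(** Triangular systems are solved from the top of the flag downwards. The
    velocity [w = D u] is again a periodic solution. If it lies in [W j.+1], a
    functional with kernel [W j] sends it to a solution of [z' = lambda z]
    with [lambda = (1 + ic) g]. For [g != 0] its modulus grows exponentially,
    so it is zero; for [g = 0] it is constant, and is the derivative of a
    periodic function, so it is zero again. Hence [w] lies in [W j]. *)
Lemma periodic_flow_constant (m : nat) (D : 'M[R]_m)
    (W : nat -> {vspace 'cV[R[i]]_m}) (lambda : nat -> R[i])
    (u : R -> 'cV[R]_m) :
  complete_flag W ->
  (forall j x, (j < m)%N -> x \in W j.+1 ->
     map_mx (real_complex R) D *m x - lambda j *: x \in W j) ->
  (forall j, (j < m)%N ->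
     exists c g : R, lambda j = Complex 1 c * real_complex R g) ->
  (forall t : R, is_derive t 1 u (D *m u t)) ->
  (forall t, u (t + 1) = u t) ->
  forall t, D *m u t = 0.
Proof.
move=> [dimW subW] DW lam du u1.
pose w t := D *m u t.
have dw (t : R) : is_derive t 1 w (D *m w t) by exact: is_derive_mulmxl.
have w1 t : w (t + 1) = w t by rewrite /w u1.
have inW j : (j <= m)%N ->
  forall t, map_mx (real_complex R) (w t) \in W (m - j)%N.
  elim: j => [_ t|j IH jm t].
    rewrite subn0; suff -> : W m = fullv by exact: memvf.
    apply/eqP; rewrite eqEdim subvf dimW //= dimvf.
    by rewrite /dim /= muln1.
  have {}IH := IH (ltnW jm).
  set k := (m - j.+1)%N; have kS : (m - j)%N = k.+1 by rewrite /k subnSK.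
  have km : (k < m)%N by rewrite -kS leq_subr.
  rewrite kS in IH.
  have [|phi [phi0 phiW]] := flag_functional (subW _ km).
    by rewrite !dimW // ltnW.
  pose rho := map_mx (@complex.Re R) phi;
    pose iota := map_mx (@complex.Im R) phi.
  pose p t := (rho *m w t) 0 0; pose q t := (iota *m w t) 0 0.
  have [c [g lamE]] := lam _ km.
  have pqE s : (rho *m (D *m w s)) 0 0 = g * (p s - c * q s) /\
               (iota *m (D *m w s)) 0 0 = g * (q s + c * p s).
    have := phi0 _ (DW _ _ km (IH s)).
    rewrite mulmxBr -scalemxAr -map_mxM => /eqP; rewrite subr_eq0 => /eqP.
    move=> /matrixP/(_ 0 0); rewrite [RHS]mxE !mulmx_complexE lamE => -[-> ->].
    by rewrite /p /q; split; ring.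
  have dp (s : R) : is_derive s 1 p (g * (p s - c * q s)).
    rewrite -(pqE s).1; apply: is_derive_mx00; exact: is_derive_mulmxl.
  have dq (s : R) : is_derive s 1 q (g * (q s + c * p s)).
    rewrite -(pqE s).2; apply: is_derive_mx00; exact: is_derive_mulmxl.
  have pq0 : p t = 0 /\ q t = 0.
    have [g0|g0] := eqVneq g 0; last first.
      by apply: (periodic_growth_zero dp dq) => // s; rewrite /p /q w1.
    have dp0 (s : R) : is_derive s 1 p 0 by have := dp s; rewrite g0 mul0r.
    have dq0 (s : R) : is_derive s 1 q 0 by have := dq s; rewrite g0 mul0r.
    have u10 : u 1 = u 0 by rewrite -[1]add0r u1.
    split.
      apply: (@constant_primitive_periodic p (fun s => (rho *m u s) 0 0)) => //.
        by move=> s; apply: is_derive_mx00; exact: is_derive_mulmxl.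
      by rewrite u10.
    apply: (@constant_primitive_periodic q (fun s => (iota *m u s) 0 0)) => //.
      by move=> s; apply: is_derive_mx00; exact: is_derive_mulmxl.
    by rewrite u10.
  apply: phiW => //; apply/matrixP => a b; rewrite !ord1 mulmx_complexE.
  by rewrite -/rho -/iota -/(p t) -/(q t) pq0.1 pq0.2 mxE.
move=> t; have := inW m (leqnn m) t.
rewrite subnn; have /eqP := dimW 0%N (leq0n m); rewrite dimv_eq0 => /eqP ->.
rewrite memv0 => /eqP wt0; apply/matrixP => i j.
by move/matrixP: wt0 => /(_ i j); rewrite !mxE => -[].
Qed.

End LinearSystems.

(** * Stabilizers in modules of exponential type *)

Section Stabilizers.
Variables (R : realType) (d : nat) (G : lieGroupType R d) (phi : chart R d G).
Variables (expG : 'rV[R]_d -> G) (m : nat) (tau : representation R G m).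
Hypotheses (expGP : exponential_map phi expG).
Hypothesis tau_exp : exponential_type expG tau.

(** The curve [t |-> tau (exp tX) v] is periodic as soon as [exp X] fixes
    [v]. *)
Lemma stabilizer_exp (X : 'rV[R]_d) (v : 'cV[R]_m) :
  stabilizer (linear_action tau) v (expG X) ->
  forall t : R, stabilizer (linear_action tau) v (expG (t *: X)).
Proof.
rewrite /stabilizer /= => Xv.
have [W [lambda [[flagW _] wt lam]]] := tau_exp.
have [[eXc eXD] _] := expGP X.
pose U (t : R) := tau (expG (t *: X)).
have Uc : continuous U.
  by apply: continuous_o; [exact: rep_continuous | exact: eXc].
have UD s t : U (s + t) = U s *m U t by rewrite /U eXD repM.
have U0 : U 0 = 1%:M by rewrite /U scale0r (exp0 expGP) rep1.
pose u t := U t *m v.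
have du (t : R) : is_derive t 1 u (drep expG tau X *m u t).
  rewrite /u mulmxA; apply: is_derive_mulmxr; exact: one_parameter_mx_derive.
have Du t : drep expG tau X *m u t = 0.
  apply: (periodic_flow_constant (lambda := fun j => lambda j X) flagW _ _ du).
  - by move=> j x jm; apply: (wt j jm).2.
  - by move=> j jm; have [c [gam ->]] := lam j jm; exists c, (gam X).
  - by move=> s; rewrite /u UD -mulmxA {2}/U scale1r Xv.
move=> t; suff : u t = u 0 by rewrite /u U0 mul1mx.
apply: (is_derive0_mx_cst_near0 (T := `|t| + 1)); last by rewrite ltrDl.
by move=> y _; rewrite -(Du y).
Qed.

End Stabilizers.

(** * Closed families of subspaces of constant dimension *)

Section SubspaceFields.
Variables (R : realType) (d : nat).

Lemma closed_vspace (C : {vspace 'rV[R]_d}) : closed [set x | x \in C].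
Proof.
pose p := daddv_pi C^C C.
have -> : [set x | x \in C] = (fun u :
  'rV[R]_d => u *m lin1_mx p) @^-1` [set 0].
  apply/seteqP; split => x /=; rewrite mul_rV_lin1 -daddv_pi_compl_eq0.
    by move/eqP.
  by move=> ->.
apply: closed_comp => [x _|]; first exact: continuous_mulmxr.
exact: (accessible_closed_set1 (hausdorff_accessible (@norm_hausdorff _ _))).
Qed.

Variables (T : topologicalType) (g : T -> {vspace 'rV[R]_d}).
Hypothesis g_closed : closed [set p : T * 'rV[R]_d | p.2 \in g p.1].

(** The triples that violate the conclusion form a closed set, so a compact
    set of pairs [(a, c)] avoiding [g v1] avoids [g v] for all [v] near [v1]. *)
Lemma tube_complement (C : {vspace 'rV[R]_d}) (v1 : T) (X1 : 'rV[R]_d)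
    (eps : R) :
  0 < eps -> (g v1 :&: C = 0)%VS -> X1 \in g v1 ->
  \forall v \near v1, forall (a : R) c, 0 <= a <= 1 -> c \in C -> `|c| = eps ->
    a *: X1 + c \notin g v.
Proof.
move=> eps0 gC X1g.
pose S := [set c : 'rV[R]_d | c \in C] `&` [set c | `|c| = eps].
have cS : compact S.
  apply: bounded_closed_compact.
    by exists eps; split; [exact: num_real | move=> x xe c [_ /= ->];
      exact: ltW].
  apply: closedI; first exact: closed_vspace.
  have -> : [set c : 'rV[R]_d | `|c| = eps] = Num.Def.normr @^-1` [set
    eps] by [].
  apply: closed_comp => [x _|]; first exact: norm_continuous.
  exact: (accessible_closed_set1 (hausdorff_accessible (@norm_hausdorff _ _))).
have cK : compact (`[0 : R, 1] `*` S).
  by apply: compact_setX => //; exact: segment_compact.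
have /compact_near_coveringP/(_ T (nbhs v1)
  (fun v ac => ac.1 *: X1 + ac.2 \notin g v) _) := cK.
move=> tube; have {tube} : \near v1, `[0 : R, 1] `*` S `<=`
    (fun ac => ac.1 *: X1 + ac.2 \notin g v1).
  apply: tube => -[a c] [/= _ [cC ce]].
  have aXc : a *: X1 + c \notin g v1.
    apply/negP => aXc; have : c \in (g v1 :&: C)%VS.
      rewrite memv_cap cC andbT -(addKr (a *: X1) c) addrC memvB //.
      exact: memvZ.
    by rewrite gC memv0 => /eqP c0; move: ce => /=; rewrite c0 normr0 => e0;
      rewrite -e0 ltxx in eps0.
  pose h (z : (R * 'rV[R]_d) * T) := (z.2, z.1.1 *: X1 + z.1.2).
  have hc : continuous h.
    apply: continuous_pair; first exact: continuous_snd.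
    have c1 := continuous_o (@continuous_fst R 'rV[R]_d) (@continuous_fst
      (R * 'rV[R]_d)%type T).
    have c2 := continuous_o (@continuous_snd R 'rV[R]_d) (@continuous_fst
      (R * 'rV[R]_d)%type T).
    move=> z; apply: (@cvgD R 'rV[R]_d); last exact: c2.
    exact: (cvgZr_tmp (c1 z)).
  have : \forall z \near ((a, c), v1), (~` [set p :
    T * 'rV[R]_d | p.2 \in g p.1]) (h z).
    apply: (hc ((a, c), v1)); apply: open_nbhs_nbhs; split.
      exact: closed_openC.
    by apply/negP.
  by apply: filterS => z /= /negP.
apply: filterS => v sub a c a01 cC ce.
by apply: (sub (a, c)); split => //=; rewrite in_itv.
Qed.

Lemma near_disjoint_complement (C : {vspace 'rV[R]_d}) (v1 : T) :
  (g v1 :&: C = 0)%VS -> \forall v \near v1, (g v :&: C = 0)%VS.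
Proof.
move=> gC; have := tube_complement ltr01 gC (mem0v _).
apply: filterS => v vP; apply/eqP; rewrite -subv0; apply/subvP => c.
rewrite memv_cap memv0 => /andP[cg cC]; apply: contraT => c0.
have := vP 1 (`|c|^-1 *: c); rewrite ler01 lexx => /(_ isT).
rewrite scaler0 add0r !memvZ // normrZ normfV normr_id mulVf ?normr_eq0 //.
by move=> /(_ isT erefl).
Qed.

(** The projection of [X0] to [g v] along a fixed complement [C] of [g v0] is
    defined as long as [g v] and [C] meet trivially, because the dimension of
    [g v] is constant; this is an open condition. If the projections at [v]
    and [v1] differ by [delta], scaling by [a = eps / |delta|] turns the one
    at [v] into the vector [a *: f v1 + a *: delta] of [g v], so that the tube
    lemma bounds [delta]. *)
Lemma subspace_field_section (s : nat) (v0 : T) (X0 : 'rV[R]_d) :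
  (forall v, \dim (g v) = s) -> X0 \in g v0 ->
  exists (V : set T) (f : T -> 'rV[R]_d),
    [/\ open V, V v0, f v0 = X0, forall v, V v -> f v \in g v &
        forall v, V v -> {for v, continuous f}].
Proof.
move=> dims X0g.
pose C := ((g v0)^C)%VS.
pose f v := daddv_pi (g v) C X0.
pose V := [set v | (g v :&: C = 0)%VS].
have fg v : f v \in g v by exact: memv_pi.
have fC v : V v -> X0 - f v \in C.
  move=> gC; have full : (g v + C = fullv)%VS.
    apply/eqP; rewrite eqEdim subvf /= dimv_disjoint_sum // dims -(dims v0).
    by rewrite -dimv_disjoint_sum ?capv_compl // addv_complf.
  have E := daddv_pi_add gC (w := X0); rewrite -[X in X - _]E ?full ?memvf //.
  by rewrite addrC addKr memv_pi.
exists V, f; split => //.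
- by rewrite openE => v; exact: near_disjoint_complement.
- exact: capv_compl.
- by rewrite /f daddv_pi_id // capv_compl.
move=> v1 Vv1; apply/cvgrPdist_lt => eps eps0.
have tube := tube_complement eps0 Vv1 (fg v1).
have Vn := near_disjoint_complement Vv1.
near=> v; have Vv : V v by near: v.
have tv : forall (a : R) c, 0 <= a <= 1 -> c \in C -> `|c| = eps ->
    a *: f v1 + c \notin g v by near: v.
rewrite ltNge; apply/negP => le_eps.
pose delta := f v - f v1.
have dC : delta \in C.
  have -> : delta = (X0 - f v1) -
    (X0 - f v) by apply/rowP => j; rewrite !mxE; ring.
  by rewrite memvB ?fC.
have nd : `|delta| = `|f v1 - f v| by rewrite distrC.
have d0 : 0 < `|delta| by rewrite nd (lt_le_trans eps0).
have a01 : 0 <= eps / `|delta| <= 1.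
  by rewrite divr_ge0 ?(ltW eps0) //= ler_pdivrMr // mul1r nd.
have := tv (eps / `|delta|) ((eps / `|delta|) *: delta) a01.
rewrite memvZ // => /(_ isT).
rewrite normrZ gtr0_norm ?divr_gt0 // divfK ?gt_eqF // => /(_ erefl).
by rewrite -scalerDr addrC subrK memvZ.
Unshelve. all: by end_near. Qed.

End SubspaceFields.

(** * Local cross-sections of the isotropy bundle *)

Section IsotropySections.
Variables (R : realType) (d : nat) (G : lieGroupType R d) (phi : chart R d G).
Variables (expG : 'rV[R]_d -> G) (m : nat) (tau : representation R G m).
Hypothesis G_exp : exponential_lie_group phi expG.
Hypothesis tau_exp : exponential_type expG tau.
Variables (Xi : set 'cV[R]_m) (r : nat).
Hypothesis Xi_dim : forall v, Xi v -> orbit_dimension expG tau v r.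

Let act := linear_action tau.

(** The space of all [X] whose one-parameter subgroup fixes [v], as provided
    by the notion of orbit dimension. *)
Definition isotropy_algebra (v : Xi) : {vspace 'rV[R]_d} :=
  sval (cid (Xi_dim (set_valP v))).

Lemma isotropy_algebraP (v : Xi) X : X \in isotropy_algebra v <->
  forall t : R, stabilizer act (val v) (expG (t *: X)).
Proof. exact: (svalP (cid (Xi_dim (set_valP v)))).1. Qed.

Lemma dim_isotropy_algebra (v : Xi) : \dim (isotropy_algebra v) = (d - r)%N.
Proof.
have := (svalP (cid (Xi_dim (set_valP v)))).2; rewrite -/(isotropy_algebra v).
by move=> rd; rewrite -[X in (X - r)%N]rd addKn.
Qed.

Lemma closed_isotropy_algebra :
  closed [set p : Xi * 'rV[R]_d | p.2 \in isotropy_algebra p.1].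
Proof.
have [phi_atlas phi1 expGP _] := G_exp.
have ec := continuous_exp phi_atlas phi1 expGP.
pose F (t : R) (p : Xi * 'rV[R]_d) :=
  tau (expG (t *: p.2)) *m val p.1 - val p.1.
have Fc t : continuous (F t).
  have c1 : continuous (fun p : Xi * 'rV[R]_d => val p.1).
    exact: (continuous_o (@continuous_set_val _ Xi) (@continuous_fst _ _)).
  have c2 : continuous (fun p : Xi * 'rV[R]_d => expG (t *: p.2)).
    apply: (continuous_o ec).
    exact: (continuous_o (@scaler_continuous _ _ t) (@continuous_snd _ _)).
  have c3 : continuous (fun p :
    Xi * 'rV[R]_d => act (expG (t *: p.2)) (val p.1)).
    exact: (continuous_o (@act_continuous _ _ act) (continuous_pair c2 c1)).
  by move=> p; apply: (@cvgB R 'cV[R]_m); [exact: c3 | exact: c1].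
have -> : [set p : Xi * 'rV[R]_d | p.2 \in isotropy_algebra p.1] =
    \bigcap_(t in [set: R]) (F t @^-1` [set 0]).
  apply/seteqP; split=> p /=.
    move=> /isotropy_algebraP pP t _ /=; have := pP t;
      rewrite /stabilizer /= /F.
    by move=> ->; rewrite subrr.
  move=> pP; apply/isotropy_algebraP => t; have := pP t I.
  by rewrite /= /F => /eqP; rewrite subr_eq0 => /eqP.
apply: closed_bigI => t _; apply: closed_comp => [p _|]; first exact: Fc.
exact: (accessible_closed_set1 (hausdorff_accessible (@norm_hausdorff _ _))).
Qed.

(** A point of the fiber over [y] is [(y, exp X0)] with [X0] in the isotropy
    algebra of [y], and [X0] extends to a continuous field of isotropy
    vectors. *)
Lemma isotropy_projection_sections :
  has_local_cross_sections (@isotropy_projection G _ act Xi).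
Proof.
have [phi_atlas phi1 expGP [logG expK logK]] := G_exp.
have ec := continuous_exp phi_atlas phi1 expGP.
move=> y x xy.
have [vx gx] : isotropy_bundle act Xi (val x) := set_valP x.
have yx : val y = (val x).1 by rewrite -xy.
pose X0 := logG (val x).2.
have X0y : X0 \in isotropy_algebra y.
  apply/isotropy_algebraP; apply: (stabilizer_exp expGP tau_exp).
  by rewrite /X0 logK yx.
have [V [f [Vo Vy fy fV fc]]] :=
  subspace_field_section closed_isotropy_algebra dim_isotropy_algebra X0y.
pose h z := if `[< V z >] then expG (f z) else 1%g.
have hP z : isotropy_bundle act Xi (val z, h z).
  split; first exact: set_valP.
  rewrite /h /=; case: asboolP => Vz; last exact: (act1 act).
  by have := (isotropy_algebraP _ _).1 (fV z Vz) 1; rewrite scale1r.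
exists V, (fun z => SigSub (mem_set (hP z))); split => //.
- apply: (@continuous_to_set_type (subspace V)).
  apply: (@subspace_eq_continuous _ _ _ (fun z : Xi => (val z, expG (f z)))).
    by move=> z zV; rewrite /= /from_subspace /= /h asboolT //; exact: set_mem.
  apply: continuous_in_subspaceT => z /set_mem Vz.
  have c2 : {for z, continuous (expG \o f)}.
    by apply: continuous_comp; [exact: fc | exact: ec].
  exact: (cvg_pair (@continuous_set_val _ Xi z) c2).
- apply: val_inj => /=; rewrite /h asboolT // fy /X0 logK yx.
  exact: (esym (surjective_pairing _)).
- by move=> z _; exact: val_inj.
Qed.

End IsotropySections.

(** * Countability and local compactness *)

Section Topology.
Variable R : realType.

Lemma hausdorff_continuous_eq (X Y : topologicalType) (f : X -> Y) (p q : X) :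
  hausdorff_space Y -> continuous f -> cluster (nbhs p) q -> f p = f q.
Proof.
move=> hY fc pq; apply: hY => A B fpA fqB.
have [x [fxA fxB]] := pq _ _ (fc p _ fpA) (fc q _ fqB).
by exists (f x).
Qed.

Lemma hausdorff_prod (X Y : topologicalType) :
  hausdorff_space X -> hausdorff_space Y -> hausdorff_space (X * Y)%type.
Proof.
move=> hX hY [x y] [x' y'] pq; congr (_, _).
  exact: (hausdorff_continuous_eq hX (@continuous_fst X Y) pq).
exact: (hausdorff_continuous_eq hY (@continuous_snd X Y) pq).
Qed.

Lemma hausdorff_set_type (X : topologicalType) (A : set X) :
  hausdorff_space X -> hausdorff_space A.
Proof.
move=> hX p q pq; apply: val_inj.
exact: (hausdorff_continuous_eq hX (@continuous_set_val X A) pq).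
Qed.

Lemma closed_equalizer (X Y : topologicalType) (f g : X -> Y) :
  hausdorff_space Y -> continuous f -> continuous g ->
    closed [set x | f x = g x].
Proof.
move=> hY fc gc x xE; apply: hY => A B fA gB.
have nAB : \forall z \near x, A (f z) /\ B (g z).
  by apply: filterI; [exact: (fc x A fA) | exact: (gc x B gB)].
have [z [/= fg [fzA gzB]]] := xE _ nAB.
by exists (f z); split => //; rewrite fg.
Qed.

Lemma countable_image (T U : Type) (f : T -> U) (A : set T) :
  countable A -> countable (f @` A).
Proof. exact/sub_countable/card_image_le. Qed.

Lemma second_countable_prod (X Y : topologicalType) :
  @second_countable X -> @second_countable Y -> @second_countable (X * Y)%type.
Proof.
move=> [B cB [Bo Bn]] [C cC [Co Cn]].
exists ((fun p => p.1 `*` p.2) @` (B `*` C)); last split.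
- by apply: countable_image; exact: countableX.
- move=> _ [[U V] [/= /Bo Uo /Co Vo] <-]; rewrite openE => -[x y] [/= Ux Vy].
  by exists (U, V) => //=; split; exact: open_nbhs_nbhs.
- move=> [x y] A [[P Q] /= [xP yQ] PQA].
  have [U [BU Ux] UP] := Bn x P xP; have [V [CV Vy] VQ] := Cn y Q yQ.
  exists (U `*` V); first by split => //; exists (U, V).
  by move=> [a b] [/= /UP Pa /VQ Qb]; exact: PQA.
Qed.

Lemma second_countable_set_type (X : topologicalType) (A : set X) :
  @second_countable X -> @second_countable A.
Proof.
move=> [B cB [Bo Bn]].
exists ((fun U => (fun y : A => val y) @^-1` U) @` B); last split.
- exact: countable_image.
- by move=> _ [U /Bo Uo <-]; exists U.
- move=> a N [_ [[Q Qo <-] Qa] QN].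
  have [U [BU Ua] UQ] := Bn (val a) Q (open_nbhs_nbhs (conj Qo Qa)).
  exists ((fun y : A => val y) @^-1` U); first by split => //; exists U.
  by move=> b /= /UQ Qb; exact: QN.
Qed.

(** The balls of radius [1 / (k + 1)] around rational matrices form a basis. *)
Lemma second_countable_mx (p n : nat) : @second_countable 'M[R]_(p, n).
Proof.
pose f (qk : 'M[rat]_(p, n) * nat) : set 'M[R]_(p, n) :=
  [set x | `|map_mx ratr qk.1 - x| < qk.2.+1%:R^-1].
exists (range f); last split.
- apply: countable_image; exact: countableP.
- move=> _ [[q k] _ <-]; rewrite openE => x fx.
  have xq : `|map_mx ratr q - x| < k.+1%:R^-1 by exact: fx.
  have xq0 : 0 < k.+1%:R^-1 - `|map_mx ratr q - x| by rewrite subr_gt0.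
  apply: filterS (near_dist_lt x xq0) => y xy.
  suff : `|map_mx ratr q - y| < k.+1%:R^-1 by [].
  apply: le_lt_trans (ler_distD x (map_mx ratr q) y) _.
  by rewrite addrC -ltrBrDr.
move=> x A /nbhs_ballP[e /= e0 eA].
have e20 : 0 < e / 2 by rewrite divr_gt0.
have [k _ /(_ k (leqnn k)) ke] := near_infty_natSinv_lt (PosNum e20).
rewrite /= in ke.
have k0 : 0 < k.+1%:R^-1 :> R by rewrite invr_gt0.
have rat_near (y : R) : {q : rat | `|ratr q - y| < k.+1%:R^-1}.
  apply: cid; have [|q] := @rat_in_itvoo R (y - k.+1%:R^-1) (y + k.+1%:R^-1).
    by rewrite ltrBlDr -addrA ltrDl addr_gt0.
  by rewrite in_itv /= => yq; exists q; rewrite ltr_distl.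
pose q := \matrix_(i, j) sval (rat_near (x i j)).
have qx : `|map_mx ratr q - x| < k.+1%:R^-1.
  by apply: mx_norm_lt => // i j; rewrite !mxE;
    exact: (svalP (rat_near (x i j))).
exists (f (q, k)); first by split => //; exists (q, k).
move=> y /= qy; apply: eA; rewrite -ball_normE /=.
have := ler_distD (map_mx ratr q) x y; rewrite [`|x - map_mx _ _|]distrC.
move: qx qy ke; rewrite /f /=; set dl := k.+1%:R^-1; move: dl => dl; lra.
Qed.

Lemma locally_compactP (X : topologicalType) : hausdorff_space X ->
  (forall x : X, exists2 K, nbhs x K & compact K) -> locally_compact [set: X].
Proof.
move=> hX H x _; have [K xK cK] := H x; exists K; first by rewrite withinET.
by split => //; exact: compact_closed.
Qed.

Lemma locally_compact_nbhs (X : topologicalType) (x : X) :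
  locally_compact [set: X] -> exists2 K, nbhs x K & compact K.
Proof. by move=> /(_ x I)[K]; rewrite withinET => xK [cK _]; exists K. Qed.

Lemma locally_compact_prod (X Y : topologicalType) :
  hausdorff_space X -> hausdorff_space Y ->
  locally_compact [set: X] -> locally_compact [set: Y] ->
  locally_compact [set: X * Y].
Proof.
move=> hX hY lX lY; apply: locally_compactP; first exact: hausdorff_prod.
move=> [x y]; have [K xK cK] := locally_compact_nbhs x lX.
have [L yL cL] := locally_compact_nbhs y lY.
by exists (K `*` L); [exists (K, L) | exact: compact_setX].
Qed.

Lemma compact_set_type (X : topologicalType) (A K : set X) :
  K `<=` A -> compact K -> compact (@set_val X A @^-1` K).
Proof.
move=> KA cK F PF FK.
have [p [Kp clp]] := cK (@set_val X A @ F) _ FK.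
exists (SigSub (mem_set (KA p Kp))); split => //.
move=> U N FU [_ [[Q Qo <-] /= Qp] QN].
have FU' : (@set_val X A @ F) (@set_val X A @` U).
  by apply: (@filterS _ F _ U) FU => a Ua; exists a.
have [_ [[a Ua <-] Qa]] := clp _ _ FU' (open_nbhs_nbhs (conj Qo Qp)).
by exists a; split => //; exact: QN.
Qed.

(** Intersect a compact neighborhood with the closed part and with the closure
    of a neighborhood contained in the open part, which exists by regularity. *)
Lemma locally_compact_set_type (X : topologicalType) (A : set X) :
  hausdorff_space X -> locally_compact [set: X] -> locally_closed A ->
  locally_compact [set: A].
Proof.
move=> hX lX [U [C [Uo Cc AE]]].
apply: locally_compactP; first exact: hausdorff_set_type.
have AP y : A y -> U y /\ C y by rewrite AE.
move=> a; have [Ua Ca] := AP _ (set_valP a).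
have [K aK cK] := locally_compact_nbhs (val a) lX.
have [W aW WU] := compact_regular hX cK aK (open_nbhs_nbhs (conj Uo Ua)).
exists (@set_val X A @^-1` (closure W `&` K `&` C)).
  have : \forall b \near a, W (val b) /\ K (val b).
    exact: (@continuous_set_val X A a (W `&` K) (filterI aW aK)).
  apply: filterS => b [Wb Kb].
  have [_ Cb] := AP _ (set_valP b).
  by split => //; split => //; exact: subset_closure.
apply: compact_set_type; first by rewrite AE => x [[/WU ? _] ?].
apply: (subclosed_compact _ cK); last by move=> x [[]].
apply: closedI => //; apply: closedI; first exact: closed_closure.
exact: compact_closed.
Qed.

Lemma compact_closed_ball_rV (n : nat) (x : 'rV[R]_n) (r : R) :
  compact [set y | `|x - y| <= r].
Proof.
apply: bounded_closed_compact.
  exists (`|x| + r); split; first exact: num_real.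
  move=> M Mr y /= xy.
  have := ler_normD (y - x) x; rewrite subrK distrC; lra.
have -> : [set y | `|x - y| <= r] =
  (fun y => `|x - y|) @^-1` [set t | t <= r] by [].
apply: closed_comp => [y _|]; last exact: closed_le.
have c1 : continuous (fun y : 'rV[R]_n => x - y).
  move=> z; apply: (@cvgB R 'rV[R]_n _ _ (nbhs_filter (z :
    'rV[R]_n)) (cst x) id); [exact: cvg_cst | exact: cvg_id].
exact: (continuous_o (@norm_continuous R 'rV[R]_n) c1).
Qed.

Lemma locally_compact_cV (n : nat) : locally_compact [set: 'cV[R]_n].
Proof.
apply: locally_compactP; first exact: norm_hausdorff.
move=> x; exists (trmx @` [set y : 'rV[R]_n | `|x^T - y| <= 1]).
  apply: filterS (near_dist_lt x ltr01) => y xy; exists y^T; last exact: trmxK.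
  apply: mx_norm_le => // i j; rewrite !mxE.
  by have := le_lt_trans (mx_norm_coord (x - y) j i) xy; rewrite !mxE => /ltW.
apply: continuous_compact; last exact: compact_closed_ball_rV.
apply: continuous_subspaceT => y.
apply: (cvg_mx (nbhs_filter (y : 'rV[R]_n))) => i j.
by rewrite mxE; under eq_fun do rewrite mxE; exact: coord_continuous.
Qed.

Lemma locally_compact_lie_group (d : nat) (G : lieGroupType R d) :
  locally_compact [set: G].
Proof.
apply: locally_compactP; first exact: lie_hausdorff.
move=> g; have [phi phi_atlas phig] := @atlas_cover R d G g.
have pg : (phi @` chart_dom phi) (phi g) by exists g.
have /nbhs_ballP[r /= r0 rP] : nbhs (phi g) (phi @` chart_dom phi).
  by apply: open_nbhs_nbhs; split => //; exact: chart_img_open.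
have r20 : 0 < r / 2 by rewrite divr_gt0.
pose K := [set y | `|phi g - y| <= r / 2].
have KP : K `<=` phi @` chart_dom phi.
  move=> y yK; apply: rP; rewrite -ball_normE /=.
  by apply: le_lt_trans yK _; lra.
exists (chart_inv phi @` K).
  have n1 : \forall h \near g, chart_dom phi h.
    by apply: open_nbhs_nbhs; split => //; exact: chart_dom_open.
  have n2 : \forall h \near g, `|phi g - phi h| < r / 2.
    exact: (chart_fun_continuous_at phig (near_dist_lt (phi g) r20)).
  near=> h; exists (phi h); last by apply: chart_funK_dom; near: h.
  by rewrite /K /= ltW //; near: h.
apply: continuous_compact; last exact: compact_closed_ball_rV.
apply: continuous_in_subspaceT => y /set_mem /KP;
  exact: chart_inv_continuous_at.
Unshelve. all: by end_near. Qed.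

End Topology.

(** * The isotropy bundle of a set *)

Section GroupBundle.

(** Near [f x], the preimage of a neighborhood of [x] under a section through
    [x] is contained in the image of that neighborhood. *)
Lemma open_map_local_cross_sections (X Y : topologicalType) (f : X -> Y) :
  has_local_cross_sections f -> open_map f.
Proof.
move=> fs U Uo; rewrite openE => _ [x Ux <-].
have [V [s [Vo Vy sc sy fsV]]] := fs (f x) x erefl.
move: sc; rewrite continuous_open_subspace // => /(_ _ (mem_set Vy)) sc.
have nV : nbhs (f x) V by apply: open_nbhs_nbhs.
have nU : \forall y \near f x, U (s y).
  by apply: sc; rewrite sy; apply: open_nbhs_nbhs.
have nVU : \forall y \near f x, V y /\ U (s y) by exact: filterI.
apply: filterS nVU => y [Vy' Uy].
by exists (s y) => //; exact: fsV.
Qed.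

Variables (G : topologicalGroupType) (X : topologicalType) (a : action G X).

Lemma act_inv g x : a (g^-1)%g (a g x) = x.
Proof. by rewrite -actM mulVg act1. Qed.

Lemma continuous_act2 (Z : topologicalType) (f : Z -> G) (h : Z -> X) :
  continuous f -> continuous h -> continuous (fun z => a (f z) (h z)).
Proof.
move=> fc hc.
exact: (continuous_o (@act_continuous _ _ a) (continuous_pair fc hc)).
Qed.

Lemma continuous_mulg2 (Z : topologicalType) (f h : Z -> G) :
  continuous f -> continuous h -> continuous (fun z => (f z * h z)%g).
Proof.
move=> fc hc.
exact: (continuous_o (@mulg_continuous G) (continuous_pair fc hc)).
Qed.

Lemma continuous_invg1 (Z : topologicalType) (f : Z -> G) :
  continuous f -> continuous (fun z => (f z)^-1%g).
Proof. by move=> fc; exact: (continuous_o (@invg_continuous G) fc). Qed.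

Variable Xi : set X.

Let T := isotropy_bundle a Xi.
Let pr := @isotropy_projection G X a Xi.

Let bP (x : Xi) (g : G) : stabilizer a (val x) g -> T (val x, g).
Proof. by move=> ag; split => //; exact: set_valP. Qed.

Definition isotropy_arrow (x : Xi) (g : G) (xg : stabilizer a (val x) g) : T :=
  SigSub (mem_set (bP xg)).

Lemma isotropy_stab (p : T) : stabilizer a (val (pr p)) (val p).2.
Proof. by have [_] := set_valP p. Qed.

Let iP (x : Xi) : stabilizer a (val x) 1%g. Proof. exact: act1. Qed.
Let vP (p : T) : stabilizer a (val (pr p)) ((val p).2^-1)%g.
Proof.
by have := isotropy_stab p; rewrite /stabilizer /= => e; rewrite -{1}e act_inv.
Qed.
Let cP (p q : T) : pr p = pr q ->
  stabilizer a (val (pr q)) ((val p).2 * (val q).2)%g.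
Proof.
move=> pq; have := isotropy_stab p; have := isotropy_stab q.
by rewrite pq /stabilizer /= actM => -> ->.
Qed.

Let isotropyE (p q : T) : pr p = pr q -> (val p).2 = (val q).2 -> p = q.
Proof.
move=> /(congr1 val) /= pq1 pq2; apply: val_inj.
rewrite (surjective_pairing (val p)) (surjective_pairing (val q)).
by congr (_, _); [exact: pq1 | exact: pq2].
Qed.

Let prc : continuous pr.
Proof.
apply: continuous_to_set_type.
exact: (continuous_o (@continuous_fst _ _) (@continuous_set_val _ T)).
Qed.
Let sndc : continuous (fun p : T => (val p).2).
Proof. exact: (continuous_o (@continuous_snd _ _)
  (@continuous_set_val _ T)). Qed.

Definition isotropy_groupoid : groupoid.
Proof.
apply: (@Groupoid T Xi pr pr (fun x => isotropy_arrow (iP x))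
  (fun p => isotropy_arrow (vP p)) (fun p q pq => isotropy_arrow (cP pq))).
- by move=> x; exact: val_inj.
- by move=> x; exact: val_inj.
- by move=> p; exact: val_inj.
- by move=> p; exact: val_inj.
- by move=> p q pq; exact: val_inj.
- by move=> p q pq; apply: val_inj; rewrite /= -[LHS](congr1 val pq).
- by move=> p q s pq qs pq_s p_qs; apply: val_inj => /=; rewrite mulgA.
- by move=> p e; apply: isotropyE => /=; [exact: val_inj | rewrite mul1g].
- by move=> p e; apply: isotropyE => /=; [exact: val_inj | rewrite mulg1].
- by move=> p e; apply: val_inj => /=; rewrite mulgV.
- by move=> p e; apply: val_inj => /=; rewrite mulVg.
- exact: prc.
- exact: prc.
- apply: continuous_to_set_type; apply: continuous_pair;
    first exact: continuous_set_val.
  exact: (@cst_continuous _ _ (1%g : G)).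
- apply: continuous_to_set_type; apply: continuous_pair.
    exact: (continuous_o (@continuous_set_val _ Xi) prc).
  exact: continuous_invg1.
- apply: continuous_to_set_type.
  pose P := [set p : T * T | pr p.1 = pr p.2].
  have P1 := continuous_o (@continuous_fst _ _) (@continuous_set_val _ P).
  have P2 := continuous_o (@continuous_snd _ _) (@continuous_set_val _ P).
  apply: continuous_pair.
    exact: (continuous_o (@continuous_set_val _ Xi) (continuous_o prc P2)).
  by apply: continuous_mulg2;
    [exact: (continuous_o sndc P1) | exact: (continuous_o sndc P2)].
Defined.

Lemma locally_closed_isotropy_bundle :
  hausdorff_space X -> locally_closed Xi -> locally_closed T.
Proof.
move=> hX [U [C [Uo Cc XiE]]].
exists (fst @^-1` U), ((fst @^-1` C) `&` [set p | a p.2 p.1 = p.1]); split.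
- by apply: open_comp => // p _; exact: continuous_fst.
- apply: closedI; first by apply: closed_comp => // p _; exact: continuous_fst.
  apply: closed_equalizer => //; last exact: continuous_fst.
  by apply: continuous_act2; [exact: continuous_snd | exact: continuous_fst].
- rewrite /T /isotropy_bundle XiE; apply/seteqP.
  by split=> p /=; rewrite /stabilizer /=; tauto.
Qed.

Lemma group_bundle_isotropy_groupoid :
  hausdorff_space X -> hausdorff_space G ->
  locally_compact [set: X] -> locally_compact [set: G] ->
  @second_countable X -> @second_countable G -> locally_closed Xi ->
  has_local_cross_sections pr -> group_bundle isotropy_groupoid.
Proof.
move=> hX hG lX lG sX sG lXi prs; split; last by [].
have hXG := hausdorff_prod hX hG.
split.
- by apply: second_countable_set_type; exact: second_countable_prod.
- apply: locally_compact_set_type => //; first exact: locally_compact_prod.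
  exact: locally_closed_isotropy_bundle.
- exact: hausdorff_set_type.
- exact: open_map_local_cross_sections.
- exact: open_map_local_cross_sections.
Qed.

Lemma locally_compact_transformation_groupoid :
  hausdorff_space X -> hausdorff_space G ->
  locally_compact [set: X] -> locally_compact [set: G] ->
  @second_countable X -> @second_countable G ->
  locally_compact_groupoid (transformation_groupoid a).
Proof.
move=> hX hG lX lG sX sG; split.
- exact: second_countable_prod.
- exact: locally_compact_prod.
- exact: hausdorff_prod.
- by move=> U Uo; exact: snd_open.
- move=> U Uo.
  have -> : @ran (transformation_groupoid a) @` U =
     snd @` (@ginv (transformation_groupoid a) @^-1` U).
    apply/seteqP; split=> x /=.
      move=> [[g y] Ugy <-]; exists (g^-1, a g y)%g => //=.
      by rewrite invgK act_inv.
    move=> [[g y] /= Ugy <-]; eexists; first exact: Ugy.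
    by rewrite /= act_inv.
  apply: snd_open; apply: open_comp => // p _;
    exact: (@ginv_continuous (transformation_groupoid a)).
Qed.

End GroupBundle.

(** * Actions with a continuous slice *)

Lemma homeomorphism_id (X : topologicalType) : homeomorphism (@id X).
Proof. by split; [move=> x; exact: cvg_id | exists id; split => // x;
  exact: cvg_id]. Qed.

Section PullbackPiece.
Variables (G : topologicalGroupType) (X : topologicalType) (a : action G X).
Variables (B Xi : set X) (sigma : X -> G).
Hypotheses (B_inv : act_invariant a B) (XiB : Xi `<=` B).
Hypothesis sigma_cont : {within B, continuous sigma}.
Hypothesis sigmaXi : forall v, B v -> Xi (a (sigma v) v).
Hypothesis Xi_orbit : forall x g, Xi x -> Xi (a g x) -> a g x = x.

Lemma groupoid_invariant_act :
  @groupoid_invariant (transformation_groupoid a) B.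
Proof.
move=> [g x]; split; first exact: B_inv.
by move=> /(B_inv (g^-1)%g); rewrite /= act_inv.
Qed.

Definition slice_map (v : B) : Xi := SigSub (mem_set (sigmaXi (set_valP v))).

Let sc : continuous (fun v : B => sigma (val v)).
Proof. exact/subspace_sigL_continuousP. Qed.

Let slice_mapE (v : B) : val (slice_map v) = a (sigma (val v)) (val v).
Proof. by []. Qed.

Lemma continuous_slice_map : continuous slice_map.
Proof.
apply: continuous_to_set_type; apply: continuous_act2; first exact: sc.
exact: continuous_set_val.
Qed.

(** Both points belong to the slice and to the orbit of [v], which the slice
    meets only once. *)
Lemma slice_map_orbit (v : B) g (x : Xi) :
  val v = a g (val x) -> slice_map v = x.
Proof.
move=> vE; apply: val_inj; rewrite slice_mapE vE -actM; apply: Xi_orbit.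
  exact: set_valP.
rewrite actM -vE; apply: sigmaXi; exact: set_valP.
Qed.

Lemma slice_map_act (v w : B) g :
  val w = a g (val v) -> slice_map w = slice_map v.
Proof.
move=> wE; apply: (slice_map_orbit (g := (g * (sigma (val v))^-1)%g)).
by rewrite wE actM slice_mapE act_inv.
Qed.

(** A point of the slice is in the image of [Q] when one of its translates is
    in [Q], so the image is the trace on the slice of a union of open sets. *)
Lemma open_map_slice_map : open_map slice_map.
Proof.
move=> _ [Q Qo <-].
have -> : slice_map @` (@set_val X B @^-1` Q) =
    @set_val X Xi @^-1` (\bigcup_(g in [set: G]) (a g @^-1` Q)).
  apply/seteqP; split=> x /=.
    move=> [v Qv <-]; exists ((sigma (val v))^-1)%g => //=.
    by rewrite -[X in Q X]/(a _ (a (sigma (val v)) (val v))) act_inv.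
  move=> [g _ /= Qgx]; have Bgx : B (a g (val x)).
    by apply: B_inv; apply: XiB; exact: set_valP.
  exists (SigSub (mem_set Bgx)); first exact: Qgx.
  exact: (slice_map_orbit (g := g)).
exists (\bigcup_(g in [set: G]) (a g @^-1` Q)) => //.
apply: bigcup_open => g _; apply: open_comp => // x _.
apply: (@continuous_act2 _ _ a X (cst g) id); first exact: cst_continuous.
by move=> z; exact: cvg_id.
Qed.

Lemma slice_map_surj : range slice_map = setT.
Proof.
apply/seteqP; split=> // x _.
exists (SigSub (mem_set (XiB (set_valP x)))) => //.
by apply: (slice_map_orbit (g := 1%g)); rewrite act1.
Qed.

Lemma slice_map_sections : has_local_cross_sections slice_map.
Proof.
move=> y x xy.
have sB (z : Xi) : B (a (sigma (val x))^-1%g (val z)).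
  by apply: B_inv; apply: XiB; exact: set_valP.
exists setT, (fun z => SigSub (mem_set (sB z))); split => //.
- exact: openT.
- apply: continuous_subspaceT; apply: continuous_to_set_type.
  by apply: continuous_act2;
    [exact: cst_continuous | exact: continuous_set_val].
- by apply: val_inj; rewrite /= -xy slice_mapE act_inv.
- by move=> z _; exact: (slice_map_orbit (g := (sigma (val x))^-1%g)).
Qed.

(* The arrows of the reduction to [B] and of the pullback of the isotropy
   bundle, written out as sets of tuples. *)
Let RA : set (G * X) := [set p | B p.2].
Let PA : set (B * isotropy_bundle a Xi * B) :=
  [set p | isotropy_projection p.1.2 = slice_map p.2 /\
           isotropy_projection p.1.2 = slice_map p.1.1].

Let rd (p : RA) : B := SigSub (mem_set (set_valP p : B (val p).2)).
Let rr (p : RA) : B :=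
  SigSub (mem_set (B_inv (val p).1 (set_valP p : B (val p).2))).

Let rdc : continuous rd.
Proof.
apply: continuous_to_set_type.
exact: (continuous_o (@continuous_snd _ _) (@continuous_set_val _ RA)).
Qed.

Let rrc : continuous rr.
Proof.
apply: continuous_to_set_type.
exact: (continuous_o (@act_continuous _ _ a) (@continuous_set_val _ RA)).
Qed.

(** The arrow [v -> gv] followed by the arrows of [sigma] from both ends to
    the slice; it ends where it starts because [v] and [gv] have the same
    image. *)
Definition slice_cocycle (p : RA) : G :=
  (sigma (val (rr p)) * (val p).1 * (sigma (val (rd p)))^-1)%g.

Let slice_map_rr (p : RA) : slice_map (rr p) = slice_map (rd p).
Proof. exact: (slice_map_act (g := (val p).1)). Qed.

Lemma slice_cocycle_stab (p : RA) :
  stabilizer a (val (slice_map (rd p))) (slice_cocycle p).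
Proof.
have e := congr1 val (slice_map_rr p); rewrite !slice_mapE in e.
suff : a (slice_cocycle p) (a (sigma (val (rd p))) (val (rd p))) =
    a (sigma (val (rd p))) (val (rd p)) by [].
by rewrite -[RHS]e /slice_cocycle !actM act_inv.
Qed.

Let FP (p : RA) : PA (rr p, isotropy_arrow (slice_cocycle_stab p), rd p).
Proof.
have e : isotropy_projection (isotropy_arrow
  (slice_cocycle_stab p)) = slice_map (rd p).
  exact: val_inj.
by split; rewrite /= e // slice_map_rr.
Qed.

Let F (p : RA) : PA := SigSub (mem_set (FP p)).

Let K0 (q : PA) : G :=
  ((sigma (val (val q).1.1))^-1 * (val (val q).1.2).2 * sigma (val
    (val q).2))%g.

Let KP (q : PA) : RA (K0 q, val (val q).2).
Proof. exact: (set_valP (val q).2). Qed.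

Let K (q : PA) : RA := SigSub (mem_set (KP q)).

Let rrK (q : PA) : rr (K q) = (val q).1.1.
Proof.
have [dq rq] := set_valP q; apply: val_inj.
have st := isotropy_stab (val q).1.2; rewrite /stabilizer /= in st.
rewrite -[LHS]/(a (K0 q) (val (val q).2)) /K0 !actM -slice_mapE -dq.
by rewrite st -[(val (val q).1.2).1]/(val (isotropy_projection
  (val q).1.2)) rq slice_mapE act_inv.
Qed.

Let FK : cancel F K.
Proof.
move=> p; apply: val_inj; rewrite [RHS]surjective_pairing; congr (_, _).
rewrite -[LHS]/(K0 (F p)) /K0 -[(val (val (F p)).1.2).2]/(slice_cocycle p).
rewrite -[(val (F p)).1.1]/(rr p) -[(val (F p)).2]/(rd p) /slice_cocycle.
by rewrite -!mulgA mulVg mulg1 mulKg.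
Qed.

Let KF : cancel K F.
Proof.
move=> q; have [dq rq] := set_valP q; apply: val_inj.
rewrite [RHS]surjective_pairing [(val q).1]surjective_pairing.
have e2 : rd (K q) = (val q).2 by exact: val_inj.
have e1 : isotropy_arrow (slice_cocycle_stab (K q)) = (val q).1.2.
  apply: val_inj; rewrite [RHS]surjective_pairing; congr (_, _).
    by rewrite e2 -dq.
  rewrite /slice_cocycle rrK e2 -[(val (K q)).1]/(K0 q) /K0.
  by rewrite !mulgA mulgV mul1g mulgK.
by rewrite -[LHS]/(rr (K q), isotropy_arrow (slice_cocycle_stab (K q)),
  rd (K q)) rrK e1 e2.
Qed.

Let Fc : continuous F.
Proof.
apply: continuous_to_set_type; apply: continuous_pair; last exact: rdc.
apply: continuous_pair; first exact: rrc.
apply: continuous_to_set_type; apply: continuous_pair.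
  exact: (continuous_o (@continuous_set_val _ Xi)
    (continuous_o continuous_slice_map rdc)).
apply: continuous_mulg2; last exact: (continuous_invg1 (continuous_o sc rdc)).
apply: continuous_mulg2; first exact: (continuous_o sc rrc).
exact: (continuous_o (@continuous_fst _ _) (@continuous_set_val _ RA)).
Qed.

Let Kc : continuous K.
Proof.
have c1 := continuous_o (@continuous_fst _ _) (@continuous_set_val _ PA).
have c2 := continuous_o (@continuous_snd _ _) (@continuous_set_val _ PA).
have c3 := continuous_o (@continuous_fst _ _) c1.
have c4 := continuous_o (@continuous_snd _ _) (continuous_o
  (@continuous_set_val _ (isotropy_bundle a Xi)) (continuous_o
    (@continuous_snd _ _) c1)).
apply: continuous_to_set_type; apply: continuous_pair; last first.
  exact: (continuous_o (@continuous_set_val _ B) c2).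
apply: continuous_mulg2; last exact: (continuous_o sc c2).
by apply: continuous_mulg2;
  [exact: (continuous_invg1 (continuous_o sc c3)) | exact: c4].
Qed.

Lemma slice_cocycleM (p q pq : RA) :
  (val p).2 = a (val q).1 (val q).2 ->
  (val pq).1 = ((val p).1 * (val q).1)%g -> (val pq).2 = (val q).2 ->
  slice_cocycle pq = (slice_cocycle p * slice_cocycle q)%g.
Proof.
move=> e e1 e2.
have rE : rr pq = rr p by apply: val_inj => /=; rewrite e1 e2 actM e.
have dE : rd pq = rd q by apply: val_inj.
have cE : rd p = rr q by apply: val_inj.
rewrite /slice_cocycle rE dE cE e1 !mulgA; congr (_ * _)%g.
by rewrite -!mulgA mulKg.
Qed.

Lemma reduced_pullback_isomorphic :
  groupoid_isomorphic (reduced_groupoid groupoid_invariant_act)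
    (@pullback_groupoid (isotropy_groupoid a Xi) B slice_map
      continuous_slice_map).
Proof.
exists F, id; split.
- by split; [exact: Fc | exists K; split; [exact: FK | exact: KF | exact: Kc]].
- exact: (homeomorphism_id B).
- by move=> p; apply: val_inj.
- by move=> p; apply: val_inj.
- move=> p q pq FpFq; apply: val_inj.
  have pqE : (val p).2 = a (val q).1 (val q).2 by exact: (congr1 val pq).
  congr (_, _, _); last exact: val_inj.
    by apply: val_inj; rewrite /= pqE actM.
  by apply: val_inj; congr (_, _); exact: slice_cocycleM.
Qed.

End PullbackPiece.

(** * The theorem *)

Theorem theorem5p4 (R : realType) (d : nat) (G : lieGroupType R d)
    (phi : chart R d G) (expG : 'rV[R]_d -> G)
    (G_exponential : exponential_lie_group phi expG)
    (m : nat) (tau : representation R G m)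
    (tau_exponential : exponential_type expG tau)
    (n : nat) (A : 'I_n -> set 'cV[R]_m)
    (A_invariant : forall k, act_invariant (linear_action tau) (A k))
    (A_cover : \bigcup_k A k = setT)
    (A_disjoint : trivIset setT A)
    (D_open : forall k : 'I_n, open (\bigcup_(j in [set j : 'I_n | (j <= k)%N]) A j))
    (Xi : 'I_n -> set 'cV[R]_m)
    (Xi_sub : forall k, Xi k `<=` A k)
    (Xi_locally_closed : forall k, locally_closed (Xi k))
    (q := orbit_map (linear_action tau))
    (q_homeo : forall k, homeomorphism_on (Xi k) (q @` A k) q)
    (theta := fun k : 'I_n => pinv (Xi k) q \o q)
    (sigma0_exists : forall k, exists sigma0 : 'cV[R]_m -> G,
       {within A k, continuous sigma0} /\
       forall v, A k v -> tau (sigma0 v) *m v = theta k v)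
    (orbit_dim : forall k, exists r : nat,
       forall v, A k v -> orbit_dimension expG tau v r) :
  (forall k, has_local_cross_sections
     (@isotropy_projection G _ (linear_action tau) (Xi k))) /\
  piecewise_pullback_of_group_bundles (transformation_groupoid (linear_action tau)).
Proof.
have Xi_sections k : has_local_cross_sections
    (@isotropy_projection G _ (linear_action tau) (Xi k)).
  have [r rA] := orbit_dim k.
  apply: (isotropy_projection_sections G_exponential tau_exponential (r := r)).
  by move=> v /Xi_sub /rA.
split=> //.
pose act := linear_action tau.
have hX : hausdorff_space 'cV[R]_m by exact: norm_hausdorff.
have hG : hausdorff_space G by exact: lie_hausdorff.
have lX : locally_compact [set: 'cV[R]_m] by exact: locally_compact_cV.
have lG : locally_compact [set: G] by exact: locally_compact_lie_group.
have sX : @second_countable 'cV[R]_m by exact: second_countable_mx.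
have sG : @second_countable G by exact: lie_second_countable.
pose V j : set 'cV[R]_m := [set v | exists2 k : 'I_n, k = j :> nat & A k v].
pose U j : set 'cV[R]_m := [set v | exists2 k : 'I_n, (k < j)%N & A k v].
have A_uniq k l v : A k v -> A l v -> k = l.
  by move=> Ak Al; apply: (A_disjoint) => //; exists v.
have orbitP x y : (q x = q y) <-> exists g, y = act g x.
  split=> [qxy|[g ->]].
    by apply/asboolP; have /eqmodP := qxy.
  by apply/eqmodP/asboolP; exists g.
exists n, V; split; first exact: locally_compact_transformation_groupoid.
exists U; split.
- by apply/seteqP; split => v // -[].
- apply/seteqP; split => v // _; have : (\bigcup_k A k) v by rewrite A_cover.
  by move=> [k _ Akv]; exists k.
- by move=> j _ v [k kj Akv]; exists k => //; exact: ltnW.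
- move=> j jn; split.
    case: j jn => [_|j jn].
      rewrite (_ : U 0%N = set0); first exact: open0.
      by apply/seteqP; split => v // -[].
    rewrite (_ : U j.+1 = \bigcup_(i in [set i :
      'I_n | (i <= Ordinal jn)%N]) A i).
      exact: D_open.
    by apply/seteqP; split=> v [k ? ?]; exists k.
  apply: groupoid_invariant_act => g v [k kj Akv]; exists k => //.
  exact: A_invariant.
move=> j jn; pose k := Ordinal jn; have VE : V j = A k.
  apply/seteqP; split=> v; last by move=> Akv; exists k.
  by move=> [l lj Alv]; rewrite (_ : k = l) //; exact: val_inj.
split.
  apply/seteqP; split=> v.
    move=> [l lj Alv]; split; first by exists l => //; rewrite lj.
    move=> [l' l'j Al'v]; have ll' := A_uniq _ _ _ Alv Al'v.
    by move: l'j; rewrite -ll' lj ltnn.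
  move=> [[l lj Alv] nU]; exists l => //; apply/eqP;
    rewrite eqn_leq -ltnS lj /=.
  by rewrite leqNgt; apply/negP => lj'; apply: nU; exists l.
rewrite VE.
have [[qim qinj qsurj] _ _] := q_homeo k.
have pinvP v : A k v ->
  Xi k (pinv (Xi k) q (q v)) /\ q (pinv (Xi k) q (q v)) = q v.
  move=> Akv; have qAv : (q @` A k) (q v) by exists v.
  split; last exact: (surjpK (fun=> point) qsurj (mem_set qAv)).
  by apply: (surjpinv_image_sub (dflt := fun=> point) qsurj); exists (q v).
have [sigma [sigma_cont sigmaE]] := sigma0_exists k.
have sigmaXi v : A k v -> Xi k (act (sigma v) v).
  by move=> Akv; rewrite -[act _ _]/(tau (sigma v) *m v) sigmaE //;
    exact: (pinvP v Akv).1.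
have Xi_orbit x g : Xi k x -> Xi k (act g x) -> act g x = x.
  move=> Xix Xigx; apply: qinj; rewrite ?inE //.
  by apply/esym/orbitP; exists g.
exists (groupoid_invariant_act (A_invariant k)), (isotropy_groupoid act (Xi k)).
exists (@slice_map G _ act (A k) (Xi k) sigma sigmaXi).
exists (@continuous_slice_map G _ act (A k)
  (Xi k) sigma sigma_cont sigmaXi); split.
- exact: group_bundle_isotropy_groupoid.
- exact: (open_map_slice_map (A_invariant k) (@Xi_sub k)).
- exact: (slice_map_surj (@Xi_sub k)).
- exact: (slice_map_sections (A_invariant k) (@Xi_sub k)).
- exact: reduced_pullback_isomorphic.
Qed.
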